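(* Let $1<p<\infty$. Then $CJN_p(\mathbb{R}^n)=VJN_p(\mathbb{R}^n)$.
   Context: A cube means an open (bounded) cube in $\mathbb{R}^n$ with edges parallel to the coordinate axes. Write $f_Q=\frac{1}{|Q|}\int_Q f$. For $1<p<\infty$, a function $f$ is in $JN_p=JN_p(\mathbb{R}^n)$ if $f\in L^1_{loc}(\mathbb{R}^n)$ and there is a constant $K<\infty$ such that $$\sum_{i=1}^\infty |Q_i|\left(\frac{1}{|Q_i|}\int_{Q_i}|f-f_{Q_i}|\right)^{p}\le K^p$$ for all countable collections of pairwise disjoint cubes $(Q_i)_{i=1}^\infty$ in $\mathbb{R}^n$; the smallest such $K$ is denoted $\|f\|_{JN_p}$. Let $D_p(\mathbb{R}^n)=\{f\in C^\infty(\mathbb{R}^n): |\nabla f|\in L^p(\mathbb{R}^n)\}$. Then $VJN_p(\mathbb{R}^n)$ is the closure of $D_p(\mathbb{R}^n)\cap JN_p$ in $JN_p$ (with respect to the (semi)norm $\|\cdot\|_{JN_p}$), and $CJN_p(\mathbb{R}^n)$ is the closure of $C_c^\infty(\mathbb{R}^n)$ in $JN_p$ (with respect to $\|\cdot\|_{JN_p}$), where $C_c^\infty(\mathbb{R}^n)$ denotes the set of smooth functions with compact support in $\mathbb{R}^n$. *)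

(* Defs.v *)
From HB Require Import structures.
From mathcomp Require Import all_boot all_order all_algebra.
From mathcomp Require Import all_classical all_reals all_analysis.

Set Implicit Arguments.
Unset Strict Implicit.
Unset Printing Implicit Defensive.

Import Order.TTheory GRing.Theory Num.Theory.
Import numFieldNormedType.Exports.

Local Open Scope classical_set_scope.
Local Open Scope ring_scope.

(* The product sigma-algebra on row vectors, generated by the coordinate
   projections, as for [n.-tuple T] in the library. *)
Section rV_measurable.
Context {d} {T : measurableType d}.
Variable n : nat.

Let coors : 'I_n -> 'rV[T]_n -> T := fun i x => x ord0 i.

Let rV_set0 : g_sigma_preimage coors set0.
Proof. exact: sigma_algebra0. Qed.

Let rV_setC A : g_sigma_preimage coors A -> g_sigma_preimage coors (~` A).
Proof. exact: sigma_algebraC. Qed.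

Let rV_bigcup (F : _^nat) : (forall i, g_sigma_preimage coors (F i)) ->
  g_sigma_preimage coors (\bigcup_i (F i)).
Proof. exact: sigma_algebra_bigcup. Qed.

HB.instance Definition _ := @isMeasurable.Build (measure_tuple_display d)
  'rV[T]_n (g_sigma_preimage coors) rV_set0 rV_setC rV_bigcup.

End rV_measurable.

Lemma measurable_coord d (T : measurableType d) n (i : 'I_n) :
  measurable_fun [set: 'rV[T]_n] (fun x : 'rV[T]_n => x ord0 i).
Proof.
move=> _ Y mY; rewrite setTI; apply: sub_sigma_algebra => /=.
rewrite -bigcup_seq/=; exists i => /=; first by rewrite mem_index_enum.
by exists Y => //; rewrite setTI.
Qed.

Lemma measurable_fun_rV d1 d2 (T1 : measurableType d1) (T2 : measurableType d2)
    n (f : T1 -> 'rV[T2]_n) :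
  (forall i, measurable_fun [set: T1] (fun x => f x ord0 i)) ->
  measurable_fun [set: T1] f.
Proof.
move=> mf _ A mA; rewrite setTI.
suff : g_sigma_preimage (fun i (x : 'rV[T2]_n) => x ord0 i)
    `<=` [set A | measurable (f @^-1` A)] by exact.
apply: smallest_sub.
  split=> /=.
  - by rewrite preimage_set0.
  - by move=> B mB; rewrite setTD preimage_setC; exact: measurableC.
  - by move=> F mF; rewrite preimage_bigcup; exact: bigcup_measurable.
rewrite -bigcup_seq/=; apply: bigcup_sub => i _ _ [B mB <-] /=.
by have := mf i measurableT B mB; rewrite !setTI.
Qed.

Section lebesgue_measure_rV.
Variable R : realType.

Definition rV_cons n (z : R * 'rV[R]_n) : 'rV[R]_n.+1 :=
  \row_i oapp (z.2 ord0) z.1 (unlift ord0 i).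

Lemma rV_cons0 n (z : R * 'rV[R]_n) : rV_cons z ord0 ord0 = z.1.
Proof. by rewrite mxE unlift_none. Qed.

Lemma rV_consS n (z : R * 'rV[R]_n) (i : 'I_n) :
  rV_cons z ord0 (lift ord0 i) = z.2 ord0 i.
Proof. by rewrite mxE liftK. Qed.

Lemma measurable_rV_cons n : measurable_fun setT (@rV_cons n).
Proof.
apply: measurable_fun_rV => i; case: (unliftP ord0 i) => [j|] ->.
  rewrite (_ : (fun _ => _) = (fun x : 'rV[R]_n => x ord0 j) \o snd).
    by apply: measurableT_comp; [exact: measurable_coord|exact: measurable_snd].
  by apply/funext => z; rewrite rV_consS.
rewrite (_ : (fun _ => _) = fst); first exact: measurable_fst.
by apply/funext => z; rewrite rV_cons0.
Qed.

Section step.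
Variables (n : nat) (m : {sigma_finite_measure set 'rV[R]_n -> \bar R}).
Local Open Scope ereal_scope.

Definition borel_lebesgue_step : set 'rV[R]_n.+1 -> \bar R :=
  pushforward (@lebesgue_measure R \x m) (@rV_cons n).

Let mcons := @measurable_rV_cons n.

Let step0 : borel_lebesgue_step set0 = 0.
Proof. by rewrite /borel_lebesgue_step /pushforward preimage_set0 measure0. Qed.

Let step_ge0 A : 0 <= borel_lebesgue_step A.
Proof. exact: measure_ge0. Qed.

Let step_sigma_additive : semi_sigma_additive borel_lebesgue_step.
Proof.
have mpre A : measurable A -> measurable (@rV_cons n @^-1` A).
  by move=> mA; rewrite -[X in measurable X]setTI; exact: mcons.
move=> F mF tF mUF; rewrite /borel_lebesgue_step /pushforward preimage_bigcup.
apply: measure_semi_sigma_additive.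
- by move=> k; exact: mpre.
- apply/trivIsetP => /= i j _ _ ij; rewrite -preimage_setI.
  by move/trivIsetP : tF => /(_ _ _ _ _ ij) ->//; rewrite preimage_set0.
- by rewrite -preimage_bigcup; exact: mpre.
Qed.

HB.instance Definition _ := isMeasure.Build _ _ _ borel_lebesgue_step
  step0 step_ge0 step_sigma_additive.

Let step_sigma_finite : sigma_finite setT borel_lebesgue_step.
Proof.
pose uncons (x : 'rV[R]_n.+1) := (x ord0 ord0, \row_j x ord0 (lift ord0 j)).
have consK : cancel (@rV_cons n) uncons.
  by move=> [a v]; rewrite /uncons rV_cons0; congr pair; apply/rowP => j;
    rewrite mxE rV_consS.
have muncons : measurable_fun setT uncons.
  apply: measurable_fun_pair; first exact: measurable_coord.
  apply: measurable_fun_rV => i; under eq_fun do rewrite mxE.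
  exact: measurable_coord.
have /sigma_finiteP[F [TF ndF Foo]] := sigma_finiteT (@lebesgue_measure R).
have /sigma_finiteP[G [TG ndG Goo]] := sigma_finiteT m.
exists (fun k => uncons @^-1` (F k `*` G k)).
  apply/seteqP; split => // x _.
  have [i _ Fi] : (\bigcup_i F i) (uncons x).1 by rewrite -TF.
  have [j _ Gj] : (\bigcup_j G j) (uncons x).2 by rewrite -TG.
  exists (maxn i j) => //; split => /=.
  - by move: Fi; exact/subsetPset/ndF/leq_maxl.
  - by move: Gj; exact/subsetPset/ndG/leq_maxr.
move=> k; have [mF Fk] := Foo k; have [mG Gk] := Goo k; split.
  rewrite -[X in measurable X]setTI; apply: muncons => //.
  exact: measurableX.
rewrite /borel_lebesgue_step /pushforward -comp_preimage.
rewrite (_ : uncons \o _ = id); last exact/funext.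
by rewrite preimage_id product_measure1E// lte_mul_pinfty// ge0_fin_numE.
Qed.

HB.instance Definition _ := Measure_isSigmaFinite.Build _ _ _
  borel_lebesgue_step step_sigma_finite.

End step.

Fixpoint borel_lebesgue n : {sigma_finite_measure set 'rV[R]_n -> \bar R} :=
  if n is n'.+1 then borel_lebesgue_step (borel_lebesgue n')
  else @dirac _ 'rV[R]_0 0 R.

Lemma measurable_box n (A : 'I_n -> set R) : (forall i, measurable (A i)) ->
  measurable [set x : 'rV[R]_n | forall i, A i (x ord0 i)].
Proof.
move=> mA; have -> : [set x : 'rV[R]_n | forall i, A i (x ord0 i)] =
    \bigcap_(i in [set: 'I_n]) [set x : 'rV[R]_n | A i (x ord0 i)].
  by apply/seteqP; split => x /= h i; [move=> _|]; exact: h.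
apply: fin_bigcap_measurable => // i _.
by have := @measurable_coord _ R n i measurableT _ (mA i); rewrite setTI.
Qed.

Lemma borel_lebesgue_box n (A : 'I_n -> set R) :
  (forall i, measurable (A i)) ->
  borel_lebesgue n [set x : 'rV[R]_n | forall i, A i (x ord0 i)] =
  (\prod_(i < n) @lebesgue_measure R (A i))%E.
Proof.
elim: n A => [|n IH] A mA.
  by rewrite big_ord0 /= diracE mem_set//= => -[].
rewrite big_ord_recl -(IH (fun i => A (lift ord0 i)))//=.
rewrite /borel_lebesgue_step /pushforward -product_measure1E//.
- congr (product_measure1 _ _); apply/seteqP; split => -[a v]/=.
    by move=> h; split=> [|i]; [have := h ord0; rewrite rV_cons0|
      have := h (lift ord0 i); rewrite rV_consS].
  move=> [ha hv] i; case: (unliftP ord0 i) => [j|] ->.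
    by rewrite rV_consS.
  by rewrite rV_cons0.
- exact: mA.
- apply: (@measurable_box n (fun i => A (lift ord0 i))) => i; exact: mA.
Qed.

(* Lebesgue measure on R^n, on the Lebesgue (completed Borel) sigma-algebra;
   for n = 1 compare [completed_lebesgue_measure]. *)
Definition lebesgue_rV n :=
  @completed_measure_extension _ _ _ (borel_lebesgue n).

HB.instance Definition _ n := Measure.on (@lebesgue_rV n).

End lebesgue_measure_rV.

Section John_Nirenberg.
Variables (R : realType) (n : nat).
Local Notation V := 'rV[R]_n.
Local Notation mu := (@lebesgue_rV R n).
(* [V] equipped with the Lebesgue sigma-algebra, the domain of [mu]. *)
Local Notation LV := (caratheodory_type (mu_ext (borel_lebesgue R n))).
Implicit Types (f g : V -> R) (Q : set V) (p : R).

Definition cube (a : V) (l : R) : set V :=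
  [set x : V | forall i, a ord0 i < x ord0 i < a ord0 i + l].

Lemma lebesgue_rV_cube a l : 0 <= l -> mu (cube a l) = (l ^+ n)%:E.
Proof.
move=> l0; pose A i := `]a ord0 i, (a ord0 i + l)[%classic.
have -> : cube a l = [set x : V | forall i, A i (x ord0 i)].
  by apply/seteqP; split => x /= h i; have := h i; rewrite /A/= in_itv.
have mA i : measurable (A i) by exact: measurable_itv.
rewrite [LHS]measurable_mu_extE/=; last exact: measurable_box.
rewrite borel_lebesgue_box// (eq_bigr (fun=> l%:E)) => [|i _].
  by rewrite prodEFin prodr_const card_ord.
rewrite lebesgue_measure_itv/= lte_fin ltrDl -EFinD addrAC subrr add0r.
by case: ltP => // l0'; congr EFin; apply/eqP; rewrite eq_le l0 l0'.
Qed.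

Definition avg f Q : R := (\int[mu]_(x in Q) f x) / fine (mu Q).

Definition mean_osc f Q : R := avg (fun x => `|f x - avg f Q|) Q.

Definition L1loc : set (V -> R) :=
  [set f | measurable_fun setT (f : LV -> R) /\
    forall K : set V, compact K -> mu.-integrable K (EFin \o f)].

Definition JN_bound p f (K : R) :=
  forall (a : nat -> V) (l : nat -> R),
    (forall i, 0 < l i) ->
    trivIset setT (fun i => cube (a i) (l i)) ->
    (\sum_(i <oo) (fine (mu (cube (a i) (l i))) *
                   mean_osc f (cube (a i) (l i)) `^ p)%:E <= (K `^ p)%:E)%E.

Definition JN p : set (V -> R) :=
  [set f | L1loc f /\ exists2 K, 0 <= K & JN_bound p f K].

(* Extended-real valued, hence +oo when no constant K is admissible. *)
Definition JN_norm p f : \bar R :=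
  ereal_inf [set K%:E | K in [set K | 0 <= K /\ JN_bound p f K]].

Definition JN_closure p (S : set (V -> R)) : set (V -> R) :=
  [set f | JN p f /\
    forall e : R, 0 < e -> exists2 g, S g & (JN_norm p (f - g)%R < e%:E)%E].

Definition partial (i : 'I_n) f : V -> R := fun x => 'D_(delta_mx ord0 i) f x.

(* C^oo: the iterated partial derivatives of all orders exist and are
   continuous; [s] lists the indices of a mixed partial derivative. *)
Definition smooth : set (V -> R) :=
  [set f | forall s : seq 'I_n,
    let g := foldr partial f s in
    continuous g /\ forall i x, derivable g x (delta_mx ord0 i)].

Definition grad_norm f : V -> R :=
  fun x => Num.sqrt (\sum_(i < n) partial i f x ^+ 2).

Definition D_ p : set (V -> R) :=
  [set f | smooth f /\ grad_norm f \in Lfun mu p%:E].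

Definition Ccoo : set (V -> R) :=
  [set f | smooth f /\ compact (closure [set x | f x != 0])].

Definition VJN p : set (V -> R) := JN_closure p (D_ p `&` JN p).

Definition CJN p : set (V -> R) := JN_closure p Ccoo.

End John_Nirenberg.

(* Main.v *)
Require Import Defs.
From mathcomp Require Import all_boot all_order all_algebra.
From mathcomp Require Import all_classical all_reals all_analysis.
From mathcomp Require Import measurable_realfun zify ring lra.

Set Implicit Arguments.
Unset Strict Implicit.
Unset Printing Implicit Defensive.

Import Order.TTheory GRing.Theory Num.Theory.
Import numFieldNormedType.Exports.

Local Open Scope classical_set_scope.
Local Open Scope ring_scope.

(** A function of [Ccoo] has a bounded gradient of compact support, hence lies in
    [D_ p]. It is bounded and integrable, hence lies in [JN p]: the terms of its
    John-Nirenberg sums are at most a constant times the integrals of its absolute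
    value over disjoint cubes. So CJN is contained in VJN. For the converse, the
    quasi-triangle inequality [JN_boundD] reduces the claim to the approximation
    of a smooth function f of JN_p by functions of [Ccoo].

    The approximant is [cutoff M * (f - c)], where the cutoff function is 1 on
    (-M, M)^n and 0 off (-2M, 2M)^n, with a Lipschitz constant of order 1 / M, and
    where c is the value of f at infinity. Constants do not oscillate, so the error
    is [(1 - cutoff M) * (f - c)], up to a constant. Write osc(Q) for the mean
    oscillation of f over a cube Q, f_Q for its average and l for the side of Q.
    Three facts make the John-Nirenberg sums of the error small.

    - [JN_tail]: the sums of f over families of cubes off (-r, r)^n are at most a
      given e^p when r is large. Otherwise families with sums above e^p could be
      found further and further away, and their union would have arbitrarily large
      sums.

    - [JN_average_limit]: for cubes Q off (-r, r)^n the average f_Q differs from c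
      by at most C e l^(-n/p). Indeed Q can be doubled repeatedly, away from the
      origin. Each doubling changes the average by at most 2^n times the
      oscillation over the larger cube, which is at most e l^(-n/p) for a cube of
      side l off (-r, r)^n, so that the changes form a geometric series. The limit
      does not depend on Q, because the doubled cubes lie in cubes of comparable
      side centred at the origin.

    - [sum_small_boxes]: for disjoint cubes Q of sides l at most M, at a distance
      of order M from the origin, the sum of |Q| (l / M)^p |f_Q - c|^p is at most
      C e^p. The average f_Q is joined to the average over a cube of side of order
      M by a chain of grid cubes with halved sides. Each step of the chain costs a
      factor 2^p in the inequality (x + y)^p <= 2^p (x^p + y^p), and these factors
      are absorbed by (l / M)^p. The grid cubes of one side form 2^n families of
      disjoint cubes, so that each generation of the chains contributes a multiple
      of e^p, with a geometrically decreasing weight.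

    With M = 2 r, these facts bound the sums of the error by C e^p
    ([sum_remainder_le]). The cubes inside (-M, M)^n contribute nothing, and on
    the cubes off (-2M, 2M)^n the error is f - c. A large cube that meets
    (-2M, 2M)^n contributes at most C e^p by the second fact, since its part off
    (-M, M)^n is covered by 2 n translates lying off (-M, M)^n; there are boundedly
    many such cubes in a family. On the remaining cubes a product rule bounds the
    oscillation of the error by 2 osc(Q) + C (l / M) |f_Q - c|, and the third fact
    applies. *)

(** * Averages and mean oscillations over cubes *)

Section averages.
Variables (R : realType) (n : nat).
Local Notation V := 'rV[R]_n.
Local Notation mu := (@lebesgue_rV R n).
Local Notation LV := (caratheodory_type (mu_ext (borel_lebesgue R n))).
Implicit Types (f g : V -> R) (q : V * R) (w : R).

Definition box q : set V := cube q.1 q.2.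

Lemma measurable_lebesgue (A : set V) :
  measurable A -> measurable (A : set LV).
Proof.
move=> mA; have := @sub_caratheodory _ _ _ (borel_lebesgue R n) A; apply.
exact: sub_sigma_algebra.
Qed.

Lemma measurable_box_lebesgue q : measurable (box q : set LV).
Proof.
apply: measurable_lebesgue; rewrite /box /cube.
rewrite (_ : [set x | _] =
    [set x : V | forall i, `]q.1 ord0 i, (q.1 ord0 i + q.2)[%classic (x ord0 i)]).
  apply: (@measurable_box _ _ (fun i => `]q.1 ord0 i, (q.1 ord0 i + q.2)[%classic)).
  by move=> i; exact: measurable_itv.
by apply/seteqP; split => x /= h i; have := h i; rewrite in_itv.
Qed.
Local Notation mbox := measurable_box_lebesgue.

Lemma mu_box q : 0 <= q.2 -> mu (box q) = (q.2 ^+ n)%:E.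
Proof. exact: lebesgue_rV_cube. Qed.

Lemma fine_mu_box q : 0 <= q.2 -> fine (mu (box q)) = q.2 ^+ n.
Proof. by move=> q0; rewrite mu_box. Qed.

Lemma mu_box_lty q : (mu (box q) < +oo)%E.
Proof.
have [q0|q0] := leP 0 q.2; first by rewrite mu_box// ltry.
have [n0|n0] := eqVneq n 0%N.
  apply: (@le_lt_trans _ _ (mu (box (q.1, 1)))); last by rewrite mu_box//= ltry.
  apply: le_measure; rewrite ?inE; [exact: mbox|exact: mbox|].
  by move=> x _ i; exfalso; have := ltn_ord i; rewrite [X in (_ < X)%N]n0.
have i : 'I_n by case: n n0 => // k _; exact: ord0.
rewrite (_ : box q = set0) ?measure0 ?ltry//; apply/seteqP; split => // x /(_ i).
by move=> /andP[/lt_trans /[apply]]; rewrite ltrDl ltNge (ltW q0).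
Qed.

Definition box_integrable f := forall q, mu.-integrable (box q) (EFin \o f).

Lemma L1loc_box_integrable f : L1loc f -> box_integrable f.
Proof.
move=> [_ fK] q; pose K := [set x : V | forall i,
  `[q.1 ord0 i, (q.1 ord0 i + q.2)]%classic (x ord0 i)].
have mK : measurable (K : set LV).
  apply: measurable_lebesgue.
  apply: (@measurable_box _ _ (fun i => `[q.1 ord0 i, (q.1 ord0 i + q.2)]%classic)).
  by move=> i; exact: measurable_itv.
apply: (@integrableS _ _ _ mu K) => //; first exact: mbox.
  by move=> x /= qx i; rewrite /= in_itv/=; have /andP[? ?] := qx i; rewrite !ltW.
apply: fK.
apply: (@rV_compact _ _ (fun i => `[q.1 ord0 i, (q.1 ord0 i + q.2)]%classic)).
by move=> i; exact: segment_compact.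
Qed.

Lemma box_integrable_cst w : box_integrable (fun=> w).
Proof.
move=> q; apply/integrableP; split; first exact: measurable_cst.
rewrite /= (integral_cst mu (mbox q)).
by rewrite lte_mul_pinfty//; exact: mu_box_lty.
Qed.

Lemma box_integrableD f g : box_integrable f -> box_integrable g ->
  box_integrable (fun x => f x + g x).
Proof. by move=> If Ig q; exact: (integrableD (mbox q) (If q) (Ig q)). Qed.

Lemma box_integrableB f g : box_integrable f -> box_integrable g ->
  box_integrable (fun x => f x - g x).
Proof. by move=> If Ig q; exact: (integrableB (mbox q) (If q) (Ig q)). Qed.

Lemma box_integrable_norm f : box_integrable f ->
  box_integrable (fun x => `|f x|).
Proof. by move=> If q; exact: integrable_norm. Qed.

Lemma box_integrable_distC f w : box_integrable f ->
  box_integrable (fun x => `|f x - w|).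
Proof.
by move=> If; apply/box_integrable_norm/box_integrableB => //; exact: box_integrable_cst.
Qed.

Lemma box_integrable_bounded f (h : V -> R) (M : R) : box_integrable f ->
  measurable_fun setT (h : LV -> R) -> (forall x, `|h x| <= M) ->
  box_integrable (fun x => h x * f x).
Proof.
move=> If mh hM q; have mhq : measurable_fun (box q : set LV) h.
  exact: measurable_funTS.
apply: (integrableMr (mbox q) mhq _ (If q)).
exists M; split; first by rewrite num_real.
by move=> y My x _; exact: (le_trans (hM x) (ltW My)).
Qed.

Definition av f q : R := avg f (box q).
Definition osc f q : R := mean_osc f (box q).

Lemma osc_av f q : osc f q = av (fun x => `|f x - av f q|) q.
Proof. by []. Qed.

Section one_box.
Variable q : V * R.
Hypothesis q0 : 0 < q.2.

Let vol0 : 0 < fine (mu (box q)).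
Proof. by rewrite fine_mu_box ?exprn_gt0// ltW. Qed.

Lemma av_le f g : box_integrable f -> box_integrable g ->
  (forall x, box q x -> f x <= g x) -> av f q <= av g q.
Proof.
move=> If Ig fg; rewrite /av /avg ler_pM2r ?invr_gt0//.
exact: (le_Rintegral (mbox q) (If q) (Ig q)).
Qed.

Lemma av_eq f g : (forall x, box q x -> f x = g x) -> av f q = av g q.
Proof.
by move=> fg; congr (_ / _); apply: eq_Rintegral => x /set_mem; exact: fg.
Qed.

Lemma av_ge0 f : (forall x, box q x -> 0 <= f x) -> 0 <= av f q.
Proof. by move=> f0; apply: divr_ge0; [exact: Rintegral_ge0|exact: ltW]. Qed.

Lemma av_cst w : av (fun=> w) q = w.
Proof. by rewrite /av /avg Rintegral_cst ?mulfK ?gt_eqF//; exact: mbox. Qed.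

Lemma avD f g : box_integrable f -> box_integrable g ->
  av (fun x => f x + g x) q = av f q + av g q.
Proof.
by move=> If Ig; rewrite /av /avg (RintegralD (mbox q) (If q) (Ig q)) mulrDl.
Qed.

Lemma avB f g : box_integrable f -> box_integrable g ->
  av (fun x => f x - g x) q = av f q - av g q.
Proof.
by move=> If Ig; rewrite /av /avg (RintegralB (mbox q) (If q) (Ig q)) mulrBl.
Qed.

Lemma avBc f w : box_integrable f -> av (fun x => f x - w) q = av f q - w.
Proof. by move=> If; rewrite avB ?av_cst//; exact: box_integrable_cst. Qed.

Lemma norm_av f : box_integrable f -> `|av f q| <= av (fun x => `|f x|) q.
Proof.
move=> If; rewrite /av /avg normrM (@ger0_norm _ (fine _)^-1); last first.
  by rewrite invr_ge0 ltW.
by rewrite ler_pM2r ?invr_gt0//; exact: (le_normr_Rintegral (mbox q) (If q)).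
Qed.

Lemma norm_avBc f w : box_integrable f ->
  `|av f q - w| <= av (fun x => `|f x - w|) q.
Proof.
move=> If; rewrite -avBc//; apply: norm_av.
by apply: box_integrableB => //; exact: box_integrable_cst.
Qed.

Lemma osc_ge0 f : 0 <= osc f q.
Proof. by rewrite osc_av av_ge0. Qed.

(** The average is, up to the factor 2, the constant that best approximates
    the function in the mean. *)
Lemma osc_le f w : box_integrable f -> osc f q <= 2 * av (fun x => `|f x - w|) q.
Proof.
move=> If; rewrite osc_av.
have I1 := box_integrable_distC w If.
have I2 := @box_integrable_cst `|av f q - w|.
apply: (@le_trans _ _ (av (fun x => `|f x - w| + `|av f q - w|) q)).
  apply: av_le; [exact: box_integrable_distC|exact: box_integrableD|].
  by move=> x _; rewrite (distrC (av f q)) (le_trans _ (ler_normD _ _))// subrKA.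
by rewrite avD// av_cst mulrDl mul1r lerD2l norm_avBc.
Qed.

Lemma Rintegral_av f : \int[mu]_(x in box q) f x = q.2 ^+ n * av f q.
Proof.
rewrite /av /avg mulrCA fine_mu_box ?ltW// mulfV ?mulr1//.
by rewrite gt_eqF ?exprn_gt0.
Qed.

End one_box.

Lemma Rintegral_le_sub (A B : set V) f : measurable (A : set LV) ->
  measurable (B : set LV) -> mu.-integrable B (EFin \o f) ->
  A `<=` B -> (forall x, 0 <= f x) ->
  \int[mu]_(x in A) f x <= \int[mu]_(x in B) f x.
Proof.
move=> mA mB If AB f0.
have IA : mu.-integrable A (EFin \o f) by exact: (integrableS mB mA AB If).
rewrite /Rintegral; apply: fine_le.
- exact: integrable_fin_num.
- exact: integrable_fin_num.
- have f0' x : B x -> (0 <= (EFin \o f) x)%E by rewrite lee_fin.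
  exact: (@ge0_subset_integral _ _ _ mu A B mA mB _ (measurable_int mu If) f0' AB).
Qed.

Lemma av_sub f q q' : 0 < q.2 -> 0 < q'.2 -> box_integrable f ->
  (forall x, 0 <= f x) -> box q `<=` box q' ->
  av f q <= (q'.2 / q.2) ^+ n * av f q'.
Proof.
move=> q0 q0' If f0 qq'; rewrite expr_div_n mulrAC ler_pdivlMr ?exprn_gt0//.
rewrite mulrC -!Rintegral_av//; apply: Rintegral_le_sub => //; exact: mbox.
Qed.

Lemma av_sub_osc f q q' : 0 < q.2 -> 0 < q'.2 -> box_integrable f ->
  box q `<=` box q' ->
  av (fun x => `|f x - av f q'|) q <= (q'.2 / q.2) ^+ n * osc f q'.
Proof.
by move=> q0 q0' If qq'; rewrite osc_av; apply: av_sub => //; exact: box_integrable_distC.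
Qed.

Lemma av_diff f q q' : 0 < q.2 -> 0 < q'.2 -> box_integrable f ->
  box q `<=` box q' ->
  `|av f q - av f q'| <= (q'.2 / q.2) ^+ n * osc f q'.
Proof.
by move=> q0 q0' If qq'; rewrite (le_trans _ (av_sub_osc _ _ _ qq'))// norm_avBc.
Qed.

(** The integrals over the cubes of a cover add up, and since all the cubes have
    the volume of [q], so do the averages. *)
Lemma av_cover f g q (F : seq (V * R)) : 0 < q.2 -> box_integrable f ->
  box_integrable g -> (forall x, 0 <= g x) ->
  (forall q', q' \in F -> q'.2 = q.2) ->
  (forall x, box q x -> f x <= 0 \/
     exists2 q', q' \in F & box q' x /\ f x <= g x) ->
  av f q <= \sum_(q' <- F) av g q'.
Proof.
move=> q0 If Ig g0 Fq fF.
have I1 q' : box_integrable (fun x => \1_(box q') x * g x).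
  apply: (@box_integrable_bounded _ _ 1) => //.
    by apply: measurable_indic; exact: mbox.
  by move=> x; rewrite indicE; case: (x \in _); rewrite ?normr1 ?normr0.
have Is (s : seq (V * R)) :
    box_integrable (fun x => \sum_(q' <- s) \1_(box q') x * g x).
  elim: s => [|a s IH].
    by under eq_fun do rewrite big_nil; exact: box_integrable_cst.
  by under eq_fun do rewrite big_cons; exact: box_integrableD.
have t0 q' x : 0 <= \1_(box q') x * g x by rewrite mulr_ge0// indicE.
apply: (@le_trans _ _ (av (fun x => \sum_(q' <- F) \1_(box q') x * g x) q)).
  apply: av_le => // x /fF[fx0|[q' q'F [q'x fgx]]].
    by apply: (le_trans fx0); apply: sumr_ge0.
  rewrite (big_rem q')//= (le_trans fgx)// indicE mem_set// mul1r lerDl.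
  by apply: sumr_ge0.
have {}Fq : forall q', q' \in F -> 0 < q'.2 /\ q'.2 = q.2.
  by move=> q' /Fq ->.
elim: F Fq {fF} => [|a s IH] Fq.
  by under av_eq do rewrite big_nil; rewrite big_nil av_cst.
under av_eq do rewrite big_cons.
rewrite big_cons avD//; apply: lerD; last first.
  by apply: IH => q' q's; apply: Fq; rewrite inE q's orbT.
have [a0 aq] := Fq a (mem_head _ _).
rewrite -(@ler_pM2l _ (q.2 ^+ n)) ?exprn_gt0// -Rintegral_av//.
have -> : q.2 ^+ n * av g a = \int[mu]_(x in box a) g x by rewrite Rintegral_av// aq.
have -> : \int[mu]_(x in box q) (\1_(box a) x * g x) =
    \int[mu]_(x in box q `&` box a) g x.
  rewrite Rintegral_mkcondr; apply: eq_Rintegral => x _.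
  by rewrite patchE indicE; case: (_ \in _); rewrite ?mul1r ?mul0r.
apply: Rintegral_le_sub => //; last exact: mbox.
by apply: measurableI; exact: mbox.
Qed.

End averages.

(** * Families of disjoint cubes and John-Nirenberg sums *)

Section families.
Variables (R : realType) (n : nat).
Local Notation V := 'rV[R]_n.
Local Notation mu := (@lebesgue_rV R n).
Local Notation LV := (caratheodory_type (mu_ext (borel_lebesgue R n))).
Implicit Types (f g : V -> R) (q : V * R) (F : seq (V * R)) (p : R).

(** For cubes of positive side, a decidable form of disjointness. *)
Definition sep q q' : bool :=
  [exists i, (q.1 ord0 i + q.2 <= q'.1 ord0 i) || (q'.1 ord0 i + q'.2 <= q.1 ord0 i)].

Definition sub_box q q' : bool :=
  [forall i, (q'.1 ord0 i <= q.1 ord0 i) && (q.1 ord0 i + q.2 <= q'.1 ord0 i + q'.2)].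

Definition family F : bool := all (fun q => 0 < q.2) F && pairwise sep F.

Definition origin_box (r : R) : V * R := (const_mx (- r), 2 * r).

Lemma sepC q q' : sep q q' = sep q' q.
Proof. by apply: eq_existsb => i; rewrite orbC. Qed.

Lemma sep_disjoint q q' x : sep q q' -> box q x -> box q' x -> False.
Proof.
move=> /existsP[i qq'] /(_ i)/andP[h1 h2] /(_ i)/andP[h3 h4].
by case/orP : qq' => h; move: h; lra.
Qed.

Lemma disjoint_sep q q' : 0 < q.2 -> 0 < q'.2 -> box q `&` box q' = set0 ->
  sep q q'.
Proof.
move=> q0 q0' qq'; apply: contrapT => /negP; rewrite negb_exists => /forallP nsep.
pose lo i := Num.max (q.1 ord0 i) (q'.1 ord0 i).
pose hi i := Num.min (q.1 ord0 i + q.2) (q'.1 ord0 i + q'.2).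
have lohi i : lo i < hi i.
  have := nsep i; rewrite negb_or -!ltNge => /andP[h1 h2].
  by rewrite /lo /hi gt_max !lt_min; apply/andP; split; apply/andP; split; lra.
suff : (box q `&` box q') (\row_i ((lo i + hi i) / 2)) by rewrite qq'.
split=> i; rewrite mxE; have := lohi i; rewrite /lo /hi.
  have h1 : q.1 ord0 i <= lo i by rewrite /lo le_max lexx.
  have h2 : hi i <= q.1 ord0 i + q.2 by rewrite /hi ge_min lexx.
  by move: h1 h2; rewrite /lo /hi => h1 h2 h3; apply/andP; split; lra.
have h1 : q'.1 ord0 i <= lo i by rewrite /lo le_max lexx orbT.
have h2 : hi i <= q'.1 ord0 i + q'.2 by rewrite /hi ge_min lexx orbT.
by move: h1 h2; rewrite /lo /hi => h1 h2 h3; apply/andP; split; lra.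
Qed.

Lemma sub_boxP q q' : sub_box q q' -> box q `<=` box q'.
Proof.
move=> /forallP qq' x qx i; have /andP[h1 h2] := qq' i; have /andP[h3 h4] := qx i.
by apply/andP; split; lra.
Qed.

Lemma sub_box_trans q q' q'' : sub_box q q' -> sub_box q' q'' -> sub_box q q''.
Proof.
move=> /forallP qq' /forallP qq''; apply/forallP => i.
have /andP[h1 h2] := qq' i; have /andP[h3 h4] := qq'' i.
by apply/andP; split; lra.
Qed.

Lemma sep_sub q q' q'' : sub_box q q' -> sep q' q'' -> sep q q''.
Proof.
move=> /forallP qq' /existsP[i h]; apply/existsP; exists i.
by have /andP[h1 h2] := qq' i; case/orP : h => h; apply/orP; [left|right]; lra.
Qed.

Lemma sub_origin_box r r' : r <= r' -> sub_box (origin_box r) (origin_box r').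
Proof. by move=> rr'; apply/forallP => i; rewrite /= !mxE; apply/andP; split; lra. Qed.

Lemma exists_origin_box F : exists2 r, 0 < r & all (sub_box^~ (origin_box r)) F.
Proof.
elim: F => [|q F [r r0 Fr]]; first by exists 1.
pose s := \sum_i `|q.1 ord0 i| + `|q.2|.
have si i : `|q.1 ord0 i| + `|q.2| <= s.
  by rewrite lerD2r (bigD1 i)//= lerDl sumr_ge0.
exists (Num.max r s); first by rewrite lt_max r0.
rewrite /=; apply/andP; split.
  apply/forallP => i; rewrite /= !mxE; have := si i.
  have : s <= Num.max r s by rewrite le_max lexx orbT.
  have := ler_norm (q.1 ord0 i); have := ler_norm (q.2).
  have := ler_norm (- q.1 ord0 i); rewrite normrN; have := normr_ge0 q.2.
  by move: (Num.max _ _) => m *; apply/andP; split; lra.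
apply: sub_all Fr => q' q'r; apply: (sub_box_trans q'r).
by apply: sub_origin_box; rewrite le_max lexx.
Qed.

Lemma family_cons q F : family (q :: F) = [&& 0 < q.2, all (sep q) F & family F].
Proof.
rewrite /family /=; case: (0 < q.2) => //=.
by case: (all (sep q) F) => //=; rewrite andbF.
Qed.

Lemma family_filter (P : pred (V * R)) F : family F -> family [seq q <- F | P q].
Proof.
move=> /andP[F0 Fs]; apply/andP; split; last exact: pairwise_filter.
by rewrite all_filter; apply: sub_all F0 => q q0; apply/implyP.
Qed.

Lemma sum_Rintegral_le (B : set V) f F : family F ->
  measurable (B : set LV) -> mu.-integrable B (EFin \o f) ->
  (forall x, 0 <= f x) -> (forall q, q \in F -> box q `<=` B) ->
  \sum_(q <- F) \int[mu]_(x in box q) f x <= \int[mu]_(x in B) f x.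
Proof.
move=> + + + f0; elim: F B => [|q F IH] B FF mB If FB.
  by rewrite big_nil; exact: Rintegral_ge0.
move: FF; rewrite family_cons => /and3P[q0 qF FF].
have mq := measurable_box_lebesgue q.
have mBq : measurable (B `\` box q : set LV) by exact: measurableD.
have qB : box q `<=` B by apply: FB; rewrite mem_head.
have BE : B = box q `|` (B `\` box q) by rewrite setDUK.
rewrite big_cons [in leRHS]BE (Rintegral_setU mq mBq)/=.
- rewrite lerD2l; apply: IH => //.
    by apply: integrableS If => //; exact: subDsetl.
  move=> q' q'F x q'x; split; first by apply: (FB q') => //; rewrite inE q'F orbT.
  by move=> qx; apply: sep_disjoint qx q'x; exact: (allP qF).
- by rewrite -BE.
- by rewrite disj_set2E setDE setICA setICr setI0.
Qed.

Lemma sum_vol_le F q' : family F -> 0 <= q'.2 -> all (sub_box^~ q') F ->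
  \sum_(q <- F) q.2 ^+ n <= q'.2 ^+ n.
Proof.
move=> FF q0' Fq'; have := @sum_Rintegral_le (box q') (fun=> 1) F FF.
rewrite Rintegral_cst; last exact: measurable_box_lebesgue.
rewrite fine_mu_box// mul1r => H.
rewrite (le_trans _ (H _ _ _ _))//.
- rewrite big_seq [leRHS]big_seq; apply: ler_sum => q qF.
  rewrite Rintegral_cst; last exact: measurable_box_lebesgue.
  by rewrite fine_mu_box ?mul1r// ltW//; case/andP : FF => /allP/(_ _ qF).
- exact: measurable_box_lebesgue.
- exact: box_integrable_cst.
- by move=> q qF; apply: sub_boxP; exact: (allP Fq').
Qed.

Definition jn_term p f q := q.2 ^+ n * osc f q `^ p.

Lemma jn_term_ge0 p f q : 0 < q.2 -> 0 <= jn_term p f q.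
Proof. by move=> q0; rewrite mulr_ge0 ?powR_ge0// exprn_ge0// ltW. Qed.

Lemma family_JN_bound p f K :
  (forall F, family F -> \sum_(q <- F) jn_term p f q <= K `^ p) -> JN_bound p f K.
Proof.
move=> H a l l0 al; apply: lime_le.
  by apply: is_cvg_nneseries => i _ _; rewrite lee_fin mulr_ge0 ?powR_ge0 ?fine_ge0.
near=> N; rewrite sumEFin lee_fin.
pose F := [seq (a i, l i) | i <- iota 0 N].
have /H : family F.
  apply/andP; split; first by apply/allP => _ /mapP[i _ ->] /=.
  rewrite /F pairwise_map; have := iota_uniq 0 N; rewrite uniq_pairwise.
  apply: sub_pairwise => i j /= ij; apply: disjoint_sep; [exact: l0|exact: l0|].
  by move/trivIsetP : al => /(_ i j I I ij).
rewrite /F big_map (eq_bigr (fun i => fine (mu (cube (a i) (l i))) *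
  mean_osc f (cube (a i) (l i)) `^ p)) => [|i _]; last first.
  by rewrite /jn_term -fine_mu_box//; exact/ltW/l0.
by rewrite /index_iota subn0.
Unshelve. all: by end_near. Qed.

(** The sequences of cubes of [JN_bound] are infinite, so that a finite family
    has to be padded, here by unit cubes lined up along the diagonal and beyond
    all the cubes of the family. *)
Lemma JN_bound_family p f K F : (0 < n)%N -> JN_bound p f K -> family F ->
  \sum_(q <- F) jn_term p f q <= K `^ p.
Proof.
move=> n0 fK /andP[F0 Fs]; pose i0 := Ordinal n0.
have [r r0 Fr] := exists_origin_box F.
pose Q k : V * R := if (k < size F)%N then nth (0, 1) F k
  else (const_mx (r + k%:R), 1).
have QF k : (k < size F)%N -> Q k \in F by move=> kF; rewrite /Q kF mem_nth.
have Qpad k : (size F <= k)%N -> Q k = (const_mx (r + k%:R), 1).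
  by rewrite leqNgt /Q => /negbTE ->.
have Q0 k : 0 < (Q k).2.
  have [kF|kF] := ltnP k (size F); last by rewrite Qpad.
  by apply: (allP F0); exact: QF.
have sepQ i j : (i < j)%N -> sep (Q i) (Q j).
  move=> ij; have [jF|jF] := ltnP j (size F).
    have iF := ltn_trans ij jF; rewrite /Q iF jF.
    by have /(pairwiseP (0, 1)) := Fs; apply.
  apply/existsP; exists i0; apply/orP; left.
  rewrite (Qpad j)//= mxE; have [iF|iF] := ltnP i (size F).
    have /forallP/(_ i0) := allP Fr _ (QF _ iF).
    rewrite !mxE => /andP[_ h]; have : 0 <= j%:R :> R by [].
    by move: h; rewrite /=; lra.
  by rewrite Qpad//= mxE -addrA lerD2l natr1 ler_nat.
have /fK : forall k, 0 < (Q k).2 by [].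
move=> /(_ (fun k => (Q k).1)) H.
have {}H := H _; rewrite -lee_fin; apply: (le_trans _ (H _)); last first.
  apply/trivIsetP => i j _ _; rewrite neq_lt => /orP[ij|ij].
    by apply/seteqP; split => // x []; apply: sep_disjoint; exact: sepQ.
  apply/seteqP; split => // x []; apply: sep_disjoint.
  by rewrite sepC; exact: sepQ.
apply: (@le_trans _ _ (\sum_(0 <= k < size F)
   (fine (mu (cube (Q k).1 (Q k).2)) *
     mean_osc f (cube (Q k).1 (Q k).2) `^ p)%:E)%E); last first.
  by apply: nneseries_lim_ge => k _; rewrite lee_fin mulr_ge0 ?powR_ge0 ?fine_ge0.
rewrite sumEFin lee_fin (big_nth (0, 1)) big_nat [leRHS]big_nat.
apply: ler_sum => k /andP[_ kF].
have -> : nth (0, 1) F k = Q k by rewrite /Q kF.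
by rewrite -[mu _]/(mu (box (Q k))) fine_mu_box// ltW.
Qed.

(** Far from the origin the John-Nirenberg sums are small: otherwise families
    of cubes lying further and further away could be put together to make the
    sums arbitrarily large. *)
Lemma JN_tail p f K eta : (0 < n)%N -> JN_bound p f K -> 0 < eta ->
  exists2 r, 0 < r & forall F, family F -> all (sep (origin_box r)) F ->
    \sum_(q <- F) jn_term p f q <= eta.
Proof.
move=> n0 fK eta0; apply: contrapT => Hn.
have {}Hn r : 0 < r -> exists F, [/\ family F, all (sep (origin_box r)) F &
    eta < \sum_(q <- F) jn_term p f q].
  move=> r0; apply: contrapT => H; apply: Hn; exists r => // F FF Fr.
  by rewrite leNgt; apply/negP => h; apply: H; exists F.
have [N KN] : exists N : nat, K `^ p < N%:R * eta.
  exists (Num.truncn (K `^ p / eta)).+1.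
  by rewrite -ltr_pdivrMr// truncnS_gt.
suff [F FF NF] : exists2 F, family F & N%:R * eta <= \sum_(q <- F) jn_term p f q.
  by have := le_trans NF (JN_bound_family n0 fK FF); rewrite leNgt KN.
elim: N {KN} => [|N [F FF NF]]; first by exists [::]; rewrite ?big_nil ?mul0r.
have [r r0 Fr] := exists_origin_box F; have [F' [FF' Fr' etaF']] := Hn _ r0.
exists (F ++ F').
  case/andP : FF => F0 Fs; case/andP : FF' => F0' Fs'.
  rewrite /family all_cat F0 F0' pairwise_cat Fs Fs' !andbT /=.
  apply/allrelP => q q' qF qF'.
  by apply: sep_sub (allP Fr' _ qF'); exact: (allP Fr).
by rewrite big_cat -natr1 mulrDl mul1r lerD// ltW.
Qed.

End families.
Arguments origin_box {R n} r.
Arguments sep {R n} q q'.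
Arguments sub_box {R n} q q'.

(** * Decay of the averages away from the origin *)

Section geometric_sequences.
Variable R : realType.

Lemma le_geometric_lim (x B C rho : R) : 0 <= rho < 1 ->
  (forall k, x <= B + C * rho ^+ k) -> x <= B.
Proof.
move=> /andP[rho0 rho1] xB.
have h : (B + geometric C rho k) @[k --> \oo] --> B + 0.
  apply: cvgD; first exact: cvg_cst.
  by apply: cvg_geometric; rewrite ger0_norm.
rewrite -[B]addr0 -(cvg_lim _ h)//; apply: limr_ge; first by apply/cvg_ex; exists (B + 0).
by near=> k; exact: xB.
Unshelve. all: by end_near. Qed.

(** With [D = C / (1 - rho)], the sequence [x m - D * rho ^+ m] increases and the
    sequence [x m + D * rho ^+ m] decreases; [c] is the supremum of the former. *)
Lemma geometric_increments_cvg (x : nat -> R) (C rho : R) : 0 <= C -> 0 <= rho < 1 ->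
  (forall m, `|x m - x m.+1| <= C * rho ^+ m) ->
  exists c, forall m, `|x m - c| <= C / (1 - rho) * rho ^+ m.
Proof.
move=> C0 /andP[rho0 rho1] xC; set D := C / (1 - rho).
have DE : D = C + D * rho by rewrite /D; field; lra.
have D0 : 0 <= D by rewrite divr_ge0// subr_ge0 ltW.
have step m : x m - D * rho ^+ m <= x m.+1 - D * rho ^+ m.+1 /\
    x m.+1 + D * rho ^+ m.+1 <= x m + D * rho ^+ m.
  have := xC m; have -> : D * rho ^+ m = C * rho ^+ m + D * rho ^+ m.+1.
    by rewrite {1}DE exprS; ring.
  by rewrite ler_norml => /andP[? ?]; split; lra.
have lo m k : x m - D * rho ^+ m <= x (m + k)%N - D * rho ^+ (m + k).
  by elim: k => [|k IH]; rewrite ?addn0// addnS (le_trans IH)//; case: (step (m + k)%N).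
have up m k : x (m + k)%N + D * rho ^+ (m + k) <= x m + D * rho ^+ m.
  by elim: k => [|k IH]; rewrite ?addn0// addnS (le_trans _ IH)//; case: (step (m + k)%N).
have pos m : 0 <= D * rho ^+ m by rewrite mulr_ge0// exprn_ge0.
have cross m k : x m - D * rho ^+ m <= x k + D * rho ^+ k.
  have := lo m k; have := up k m; rewrite addnC; have := pos (m + k)%N; lra.
pose E := range (fun m => x m - D * rho ^+ m).
have supE : has_sup E.
  split; first by exists (x 0%N - D * rho ^+ 0), 0%N.
  by exists (x 0%N + D * rho ^+ 0) => _ [m _ <-].
exists (sup E) => m; rewrite ler_distlC; apply/andP; split.
  by apply: sup_upper_bound => //; exists m.
by apply: sup_le_ub; [case: supE|move=> _ [k _ <-]].
Qed.

End geometric_sequences.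

Section decay.
Variables (R : realType) (n : nat) (p : R).
Hypotheses (n0 : (0 < n)%N) (p0 : 0 < p).
Local Notation V := 'rV[R]_n.
Implicit Types (f g : V -> R) (q : V * R) (F : seq (V * R)).

(** The size that the mean oscillation over a cube of side [l] may have when
    the corresponding John-Nirenberg term is at most 1. *)
Definition scale (l : R) : R := l `^ (- (n%:R / p)).

Definition ratio : R := scale 2.

Lemma scale_gt0 l : 0 < l -> 0 < scale l.
Proof. by move=> l0; exact: powR_gt0. Qed.

Lemma scaleM l l' : 0 <= l -> 0 <= l' -> scale (l * l') = scale l * scale l'.
Proof. exact: powRM. Qed.

Lemma scale_exp2 m : scale (2 ^+ m) = ratio ^+ m.
Proof.
by rewrite /scale /ratio -powR_mulrn// powRAC powR_mulrn// powR_ge0.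
Qed.

Lemma scale_powR l : 0 < l -> scale l `^ p = l ^- n.
Proof.
move=> l0; rewrite -powRrM mulNr divfK ?gt_eqF// powR_invn//; exact: ltW.
Qed.

Lemma ratio_bound : 0 <= ratio < 1.
Proof.
rewrite powR_ge0 /ratio /scale powRN invf_lt1 ?powR_gt0//.
rewrite /powR pnatr_eq0 /= -[ltLHS]expR0 ltr_expR mulr_gt0//.
  by rewrite divr_gt0// ltr0n.
by rewrite ln_gt0// ltr1n.
Qed.

Lemma osc_le_scale f q (e : R) : 0 < q.2 -> 0 <= e ->
  jn_term p f q <= e `^ p -> osc f q <= e * scale q.2.
Proof.
move=> q0 e0 h; rewrite leNgt; apply/negP => lt_osc.
have es0 : 0 <= e * scale q.2 by rewrite mulr_ge0// ltW// scale_gt0.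
have : (e * scale q.2) `^ p < osc f q `^ p.
  by apply: gt0_ltr_powR; rewrite ?nnegrE// osc_ge0.
rewrite powRM ?scale_powR//; last by rewrite ltW// scale_gt0.
rewrite ltr_pdivrMr ?exprn_gt0// mulrC => /lt_le_trans/(_ h).
by rewrite ltxx.
Qed.

(** Doubling a cube moves the average by at most the oscillation of the larger
    cube; along repeated doublings these changes form a geometric series. *)
Lemma av_iter_double f (e : R) (T : pred (V * R)) (g : V * R -> V * R) :
  box_integrable f -> 0 <= e ->
  (forall q, (g q).2 = 2 * q.2) -> (forall q, 0 < q.2 -> sub_box q (g q)) ->
  (forall q, 0 < q.2 -> T q -> T (g q)) ->
  (forall q, 0 < q.2 -> T q -> osc f q <= e * scale q.2) ->
  forall k q, 0 < q.2 -> T q ->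
  `|av f q - av f (iter k g q)| <= 2 ^+ n / (1 - ratio) * (e * scale q.2).
Proof.
move=> If e0 g2 gsub gT fT; have /andP[rho0 rho1] := ratio_bound.
elim=> [|k IH] q q0 Tq.
  rewrite /= subrr normr0 mulr_ge0 ?divr_ge0 ?exprn_ge0 ?subr_ge0 ?(ltW rho1)//.
  by rewrite mulr_ge0// ltW// scale_gt0.
have gq0 : 0 < (g q).2 by rewrite g2 mulr_gt0.
rewrite iterSr (le_trans (ler_distD (av f (g q)) _ _))//.
have h1 : `|av f q - av f (g q)| <= 2 ^+ n * (e * scale (g q).2).
  apply: (le_trans (av_diff q0 gq0 If (sub_boxP (gsub _ q0)))).
  by rewrite g2 mulfK ?gt_eqF// ler_pM2l ?exprn_gt0// -g2 fT// gT.
have h2 := IH _ gq0 (gT _ q0 Tq).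
apply: (le_trans (lerD h1 h2)); rewrite g2 scaleM// ?(ltW q0)// -/ratio.
have -> : 2 ^+ n * (e * (ratio * scale q.2)) +
    2 ^+ n / (1 - ratio) * (e * (ratio * scale q.2)) =
    2 ^+ n / (1 - ratio) * (e * scale q.2) * (ratio * (2 - ratio)).
  by field; lra.
rewrite ler_piMr//; last nra.
rewrite mulr_ge0 ?divr_ge0 ?exprn_ge0 ?subr_ge0 ?(ltW rho1)//.
by rewrite mulr_ge0// ltW// scale_gt0.
Qed.

(** The averages over the cubes [origin_box (2 ^ m)] converge to a constant
    [c], and then so do the averages over every sequence of doublings. A cube
    away from the origin can be doubled without coming closer to the origin,
    so that its average is close to [c] in terms of the John-Nirenberg sums
    away from the origin. *)
Lemma JN_average_limit f K : box_integrable f -> 0 <= K -> JN_bound p f K ->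
  exists c, forall e r, 0 <= e ->
    (forall F, family F -> all (sep (origin_box r)) F ->
      \sum_(q <- F) jn_term p f q <= e `^ p) ->
    forall q, 0 < q.2 -> sep (origin_box r) q ->
      `|av f q - c| <= 2 ^+ n / (1 - ratio) * (e * scale q.2).
Proof.
move=> If K0 fK; have /andP[rho0 rho1] := ratio_bound.
have single (P : pred (V * R)) e : 0 <= e -> (forall F, family F -> all P F ->
      \sum_(q <- F) jn_term p f q <= e `^ p) ->
    forall q, 0 < q.2 -> P q -> osc f q <= e * scale q.2.
  move=> e0 H q q0 Pq; apply: osc_le_scale => //.
  have := H [:: q]; rewrite big_seq1 /family /= q0 Pq; exact.
have fK1 q : 0 < q.2 -> osc f q <= K * scale q.2.
  move=> q0; apply: (single xpredT K) => // F FF _.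
  exact: JN_bound_family fK FF.
pose N m : V * R := origin_box (2 ^+ m).
have N2 m : (N m).2 = 2 ^+ m.+1 by rewrite exprS.
have N0 m : 0 < (N m).2 by rewrite N2 exprn_gt0.
have oscN m : osc f (N m) <= K * ratio ^+ m.
  apply: (le_trans (fK1 _ (N0 m))); rewrite N2 scale_exp2 ler_wpM2l//.
  by rewrite exprS ler_piMl ?exprn_ge0// ltW.
have [c Nc] : exists c, forall m,
    `|av f (N m) - c| <= 2 ^+ n * K / (1 - ratio) * ratio ^+ m.
  apply: geometric_increments_cvg; rewrite ?mulr_ge0 ?rho0// => m.
  have sN : sub_box (N m) (N m.+1) by apply: sub_origin_box; rewrite ler_eXn2l ?ltr1n.
  apply: (le_trans (av_diff (N0 m) (N0 m.+1) If (sub_boxP sN))).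
  have -> : (N m.+1).2 / (N m).2 = 2 by rewrite !N2 exprS mulfK// expf_neq0.
  rewrite -mulrA ler_pM2l ?exprn_gt0//.
  apply: (le_trans (oscN _)); rewrite ler_wpM2l//.
  by rewrite exprS ler_piMl ?exprn_ge0// ltW.
exists c => e r e0 tail.
have limit (T : pred (V * R)) (g : V * R -> V * R) q :
    (forall q, (g q).2 = 2 * q.2) -> (forall q, 0 < q.2 -> sub_box q (g q)) ->
    (forall q i, 0 < q.2 -> `|(g q).1 ord0 i| <= `|q.1 ord0 i| + q.2) ->
    (forall q, 0 < q.2 -> T q -> T (g q)) ->
    (forall q, 0 < q.2 -> T q -> sep (origin_box r) q) ->
    0 < q.2 -> T q -> `|av f q - c| <= 2 ^+ n / (1 - ratio) * (e * scale q.2).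
  move=> g2 gsub gbd gT Tr q0 Tq.
  have chain k : `|av f q - av f (iter k g q)| <= 2 ^+ n / (1 - ratio) * (e * scale q.2).
    apply: (@av_iter_double f e T g) => // q' q0' Tq'.
    by apply: (single (sep (origin_box r))) => //; exact: Tr.
  have [m qm] : exists m, forall i, `|q.1 ord0 i| <= 2 ^+ m /\ q.2 <= 2 ^+ m.
    pose s := \sum_i `|q.1 ord0 i| + q.2; exists (Num.truncn s).+1 => i.
    have sm : s <= 2 ^+ (Num.truncn s).+1.
      apply: ltW; apply: (lt_trans (truncnS_gt _)).
      by rewrite -natrX ltr_nat ltn_expl.
    split; apply: le_trans sm; rewrite /s (bigD1 i)//=.
      by rewrite -addrA lerDl addr_ge0 ?(ltW q0)// sumr_ge0.
    by rewrite lerDr addr_ge0// sumr_ge0.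
  have it2 k : (iter k g q).2 = 2 ^+ k * q.2.
    by elim: k => [|k IH]; rewrite ?mul1r// iterS g2 IH exprS mulrA.
  have it0 k : 0 < (iter k g q).2 by rewrite it2 mulr_gt0// exprn_gt0.
  have itm k i : `|(iter k g q).1 ord0 i| <= 2 ^+ (m + k) /\
      (iter k g q).2 <= 2 ^+ (m + k).
    elim: k => [|k [IH1 IH2]]; first by rewrite addn0; exact: qm.
    rewrite iterS addnS exprS; split.
      by apply: (le_trans (gbd _ _ (it0 k))); lra.
    by rewrite g2 ler_pM2l.
  have itN k : sub_box (iter k g q) (N (m + k).+1).
    apply/forallP => i; have [h1 h2] := itm k i; rewrite /= !mxE exprS.
    by move: h1; rewrite ler_norml => /andP[h3 h4]; apply/andP; split; lra.
  have i0 : 'I_n by case: n n0 => // j _; exact: ord0.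
  pose C := ((2 ^+ m.+2 / q.2) ^+ n + 2 ^+ n / (1 - ratio)) * K.
  apply: (@le_geometric_lim _ _ _ C ratio); first by rewrite rho0.
  move=> k; apply: (le_trans (ler_distD (av f (iter k g q)) _ _)).
  apply: lerD; first exact: chain.
  apply: (le_trans (ler_distD (av f (N (m + k).+1)) _ _)).
  have rk : ratio ^+ (m + k).+1 <= ratio ^+ k.
    by apply: ler_wiXn2l => //; [exact: ltW|rewrite -addSn leq_addl].
  rewrite /C 2!mulrDl; apply: lerD; last first.
    apply: (le_trans (Nc _)); rewrite [2 ^+ n * K / _]mulrAC.
    by rewrite ler_wpM2l// mulr_ge0// divr_ge0 ?exprn_ge0 ?subr_ge0 ?(ltW rho1).
  apply: (le_trans (av_diff (it0 k) (N0 _) If (sub_boxP (itN k)))).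
  rewrite N2 it2.
  have -> : 2 ^+ (m + k).+2 / (2 ^+ k * q.2) = 2 ^+ m.+2 / q.2.
    by rewrite -!addSn exprD; field; rewrite (gt_eqF q0)/= expf_neq0.
  rewrite -[leRHS]mulrA ler_pM2l; last by rewrite exprn_gt0// divr_gt0// exprn_gt0.
  by apply: (le_trans (oscN _)); rewrite ler_wpM2l.
move=> q q0 /existsP[i]; rewrite /= !mxE => h.
case/orP: h => h.
  (* keep the lower corner *)
  pose T : pred (V * R) := fun q => r <= q.1 ord0 i.
  apply: (@limit T (fun q => (q.1, 2 * q.2))) => //.
  - by move=> q' q0'; apply/forallP => j; rewrite lexx /= lerD2l; lra.
  - by move=> q' j q0'; rewrite lerDl ltW.
  - move=> q' q0'; rewrite /T => rq'; apply/existsP; exists i; rewrite /= !mxE.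
    by apply/orP; left; lra.
  - by rewrite /T; lra.
(* keep the upper corner *)
pose T : pred (V * R) := fun q => q.1 ord0 i + q.2 <= - r.
apply: (@limit T (fun q => (q.1 - const_mx q.2, 2 * q.2))) => //.
- by move=> q' q0'; apply/forallP => j; rewrite /= !mxE; apply/andP; split; lra.
- move=> q' j q0'; rewrite /= !mxE (le_trans (ler_normB _ _))//.
  by rewrite (gtr0_norm q0').
- by move=> q' q0'; rewrite /T /= !mxE; lra.
- move=> q' q0'; rewrite /T => rq'; apply/existsP; exists i; rewrite /= !mxE.
  by apply/orP; right.
Qed.

End decay.

(** * Chains of grid cubes *)

Section grid.
Variables (R : realType) (n : nat).
Local Notation V := 'rV[R]_n.
Implicit Types (f g : V -> R) (q : V * R) (F : seq (V * R)) (p s : R).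
Implicit Types (a : V) (z : 'rV[int]_n).

(** The cubes of side [2 s] with corners on the grid [s Z^n]. Those with the
    parities of [z] fixed are pairwise disjoint, and every cube of side at most
    [s] lies in the one given by the grid point below its lower corner. *)
Definition grid_box s z : V * R := (\row_i (s * (z ord0 i)%:~R), 2 * s).

Definition grid_index s a : 'rV[int]_n := \row_i Num.floor (a ord0 i / s).

Definition grid_cover s q : V * R := grid_box s (grid_index s q.1).

Definition parity z : {ffun 'I_n -> bool} := [ffun i => (z ord0 i %% 2)%Z == 0].

Lemma grid_index_itv s a i : 0 < s ->
  s * (grid_index s a ord0 i)%:~R <= a ord0 i < s * (grid_index s a ord0 i)%:~R + s.
Proof.
move=> s0; rewrite mxE; have /andP[h1 h2] := floor_itv (a ord0 i / s).
rewrite ler_pdivlMr// in h1; rewrite intrD ltr_pdivrMr// mulrDl mul1r in h2.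
by rewrite mulrC h1 h2.
Qed.

Lemma grid_coverE s q i :
  (grid_cover s q).1 ord0 i = s * (grid_index s q.1 ord0 i)%:~R.
Proof. by rewrite [LHS]mxE. Qed.

Lemma sub_grid_cover s q : 0 < s -> q.2 <= s -> sub_box q (grid_cover s q).
Proof.
move=> s0 qs; apply/forallP => i; rewrite !grid_coverE /=.
by have /andP[h1 h2] := grid_index_itv q.1 i s0; apply/andP; split; lra.
Qed.

Lemma grid_cover_half s q : 0 < s ->
  sub_box (grid_cover (s / 2) q) (grid_cover s q).
Proof.
move=> s0; have s20 : 0 < s / 2 by rewrite divr_gt0.
apply/forallP => i; rewrite !grid_coverE [X in _ && X]/=.
have /andP[h1 h2] := grid_index_itv q.1 i s0.
have /andP[h3 h4] := grid_index_itv q.1 i s20.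
apply/andP; split; last lra.
have : 2 * grid_index s q.1 ord0 i <= grid_index (s / 2) q.1 ord0 i.
  rewrite [in leRHS]mxE floor_ge_int_tmp intrM ler_pdivlMr//.
  by apply: le_trans h1; rewrite le_eqVlt; apply/orP; left; apply/eqP; field.
rewrite -(ler_int R) intrM => h; rewrite -(ler_pM2l s20) in h.
by move: h; rewrite mulrA divfK.
Qed.

Lemma grid_box_sep s z z' : 0 < s -> parity z = parity z' -> z != z' ->
  sep (grid_box s z) (grid_box s z').
Proof.
move=> s0 pz /eqP zz'.
have [i zi] : exists i, z ord0 i <> z' ord0 i.
  apply: contrapT => H; apply: zz'; apply/rowP => i.
  by apply: contrapT => ?; apply: H; exists i.
have : (z ord0 i + 2 <= z' ord0 i) \/ (z' ord0 i + 2 <= z ord0 i).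
  by move/ffunP/(_ i): pz; rewrite !ffunE; lia.
move=> h; apply/existsP; exists i; rewrite /= !mxE.
by case: h => h; apply/orP; [left|right]; move: h;
  rewrite -(ler_int R) intrD -(ler_pM2l s0); lra.
Qed.

(** The members of [F] with a common cover have total volume at most that of the
    cover, and the covers with equal parities form a family; there are [2 ^ n]
    parities. *)
Lemma sum_grid_cover p f s r F (eta : R) : 0 < s ->
  (forall G, family G -> all (sep (origin_box r)) G ->
    \sum_(q <- G) jn_term p f q <= eta) ->
  family F -> all (fun q => q.2 <= s) F ->
  all (fun q => sep (origin_box r) (grid_cover s q)) F ->
  \sum_(q <- F) q.2 ^+ n * osc f (grid_cover s q) `^ p <= 2 ^+ n * eta.
Proof.
move=> s0 tail FF Fs Fr; pose zc q := grid_index s q.1.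
pose Z := undup (map zc F).
pose h q := q.2 ^+ n * osc f (grid_cover s q) `^ p.
have -> : \sum_(q <- F) q.2 ^+ n * osc f (grid_cover s q) `^ p =
    \sum_(z <- Z) \sum_(q <- F | zc q == z) h q.
  under [RHS]eq_bigr => z _ do rewrite big_mkcond.
  rewrite exchange_big /= big_seq [RHS]big_seq; apply: eq_bigr => q qF.
  have qZ : zc q \in Z by rewrite mem_undup map_f.
  rewrite (bigD1_seq _ qZ (undup_uniq _)) /= eqxx big1 ?addr0// => z.
  by rewrite eq_sym => /negbTE ->.
apply: (@le_trans _ _ (\sum_(z <- Z) jn_term p f (grid_box s z))).
  apply: ler_sum => z _.
  apply: (@le_trans _ _ ((\sum_(q <- F | zc q == z) q.2 ^+ n) *
      osc f (grid_box s z) `^ p)).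
    rewrite mulr_suml; apply: ler_sum => q /eqP <-; exact: lexx.
  apply: ler_wpM2r; first exact: powR_ge0.
  rewrite -big_filter; apply: sum_vol_le.
  - exact: family_filter.
  - by rewrite /= mulr_ge0// ltW.
  - rewrite all_filter; apply/allP => q qF; apply/implyP => /eqP <-.
    by apply: sub_grid_cover => //; exact: (allP Fs).
rewrite (partition_big parity xpredT)//=.
apply: (@le_trans _ _ (\sum_(b : {ffun 'I_n -> bool}) eta)); last first.
  have -> : 2 ^+ n * eta = eta *+ (2 ^ n) by rewrite -[RHS]mulr_natl natrX.
  by rewrite sumr_const card_ffun card_bool card_ord.
apply: ler_sum => b _; rewrite -big_filter -(big_map (grid_box s) xpredT).
apply: tail.
  apply/andP; split.
    by apply/allP => _ /mapP[z _ ->] /=; rewrite mulr_gt0.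
  rewrite pairwise_map.
  have : pairwise [rel z z' | (parity z == b) && (parity z' == b) && (z != z')]
      [seq z <- Z | parity z == b].
    rewrite pairwise_relI; apply/andP; split; last first.
      by rewrite -uniq_pairwise filter_uniq// undup_uniq.
    apply/(pairwiseP 0) => i j; rewrite !inE => iz jz ij /=.
    have := mem_nth 0 iz; have := mem_nth 0 jz.
    by rewrite !mem_filter => /andP[-> _] /andP[-> _].
  apply: sub_pairwise => z z' /= /andP[/andP[/eqP zb /eqP z'b] zz'].
  by apply: grid_box_sep => //; rewrite zb z'b.
apply/allP => _ /mapP[z + ->]; rewrite mem_filter mem_undup => /andP[_ /mapP[q qF ->]].
exact: (allP Fr).
Qed.

End grid.

Section chains.
Variables (R : realType) (n : nat) (p : R).
Hypothesis p1 : 1 < p.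
Local Notation V := 'rV[R]_n.
Implicit Types (f g : V -> R) (q : V * R) (F : seq (V * R)).

Let p0 : 0 < p. Proof. exact: lt_trans p1. Qed.

Lemma powRD_le (x y : R) : 0 <= x -> 0 <= y ->
  (x + y) `^ p <= 2 `^ p * (x `^ p + y `^ p).
Proof.
move=> x0 y0; wlog xy : x y x0 y0 / x <= y => [H|].
  by have [/H|/ltW/H] := leP x y; [exact|rewrite addrC [_ `^ p + _]addrC; exact].
apply: (@le_trans _ _ ((2 * y) `^ p)).
  by apply: ge0_ler_powR; rewrite ?nnegrE ?(ltW p0)//; lra.
by rewrite powRM// ler_pM2l ?powR_gt0// lerDr powR_ge0.
Qed.

Lemma powR_half_le m : (2^-1 ^+ m : R) `^ p <= 2^-1 ^+ m.
Proof.
apply: ge1r_powR; last exact: ltW.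
by rewrite exprn_gt0//= exprn_ile1//; lra.
Qed.

(** The average over a small cube is reached from the average over a large one
    through a chain of grid cubes with halved sides. Each step costs a factor
    [2 `^ p] in [powRD_le], which the powers of [2^-1] on the left absorb. *)
Lemma grid_chain f q (c s : R) k : box_integrable f -> 0 < s -> 0 < q.2 ->
  q.2 <= s * 2^-1 ^+ k ->
  (2^-1 ^+ k * `|av f (grid_cover (s * 2^-1 ^+ k) q) - c|) `^ p <=
  `|av f (grid_cover s q) - c| `^ p +
  (2 ^+ n) `^ p * \sum_(j < k) 2^-1 ^+ j * osc f (grid_cover (s * 2^-1 ^+ j) q) `^ p.
Proof.
move=> If s0 q0; elim: k => [|k IH] qs.
  by rewrite big_ord0 mulr0 addr0 expr0 mulr1 mul1r.
set t := 2^-1 ^+ k : R; have t0 : 0 < t by rewrite exprn_gt0.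
have st0 : 0 < s * t by rewrite mulr_gt0.
have sE : s * 2^-1 ^+ k.+1 = (s * t) / 2 by rewrite exprSr mulrA.
have qst : q.2 <= s * t by move: qs; rewrite sE; lra.
rewrite big_ord_recr /= mulrDr addrA; apply: le_trans (lerD (IH qst) (lexx _)).
set P := grid_cover (s * t) q; set P' := grid_cover _ q.
have P0 : 0 < P.2 by rewrite /= mulr_gt0.
have P0' : 0 < P'.2 by rewrite /= mulr_gt0// mulr_gt0// exprn_gt0.
have P'P : box P' `<=` box P.
  by rewrite /P' sE; apply: sub_boxP; exact: grid_cover_half.
have diff : `|av f P' - c| <= `|av f P - c| + 2 ^+ n * osc f P.
  rewrite [leRHS]addrC (le_trans (ler_distD (av f P) _ _))// lerD2r.
  apply: (le_trans (av_diff P0' P0 If P'P)).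
  rewrite /= sE; have -> : 2 * (s * t) / (2 * (s * t / 2)) = 2 by field; lra.
  exact: lexx.
have oP : 0 <= osc f P by exact: osc_ge0.
have tx : 0 <= t * `|av f P - c| by exact: mulr_ge0 (ltW t0) _.
have oP' : 0 <= 2 ^+ n * osc f P by exact: mulr_ge0 (exprn_ge0 _ _) oP.
have ty : 0 <= t * (2 ^+ n * osc f P) by exact: mulr_ge0 (ltW t0) oP'.
apply: (@le_trans _ _ ((2^-1 * (t * `|av f P - c| + t * (2 ^+ n * osc f P))) `^ p)).
  apply: ge0_ler_powR; rewrite ?nnegrE ?(ltW p0)//.
    by apply: mulr_ge0 => //; exact: addr_ge0.
  by rewrite exprS -/t -mulrA ler_pM2l// -mulrDr ler_pM2l.
rewrite powRM//; last exact: addr_ge0.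
have -> : (2^-1 : R) `^ p = (2 `^ p)^-1.
  by rewrite -powR_inv1// powRAC powR_inv1// powR_ge0.
rewrite ler_pdivrMl ?powR_gt0//.
apply: (le_trans (powRD_le tx ty)).
rewrite ler_pM2l ?powR_gt0// lerD2l.
rewrite (powRM _ (ltW t0) oP') (powRM _ (exprn_ge0 _ _) oP)//.
by rewrite mulrCA ler_wpM2l ?powR_ge0// ler_wpM2r ?powR_ge0// powR_half_le.
Qed.

(** The same chain with a last step, from a grid cube down to [q]; the side of
    that grid cube is less than [4 * q.2], whence the factor [4 ^+ n]. *)
Lemma grid_chain_small f q (c s : R) N : box_integrable f -> 0 < s ->
  0 < q.2 <= s -> s * 2^-1 ^+ N < q.2 ->
  (q.2 / s * `|av f q - c|) `^ p <=
  2 `^ p * (`|av f (grid_cover s q) - c| `^ p +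
  (4 ^+ n) `^ p * \sum_(j < N | q.2 <= s * 2^-1 ^+ j)
      2^-1 ^+ j * osc f (grid_cover (s * 2^-1 ^+ j) q) `^ p).
Proof.
move=> If s0 /andP[q0 qs] qN.
(* [k] is the number of halvings until the grid cubes match the side of [q] *)
have [k [kN qk kq]] : exists k, [/\ (k < N)%N, q.2 <= s * 2^-1 ^+ k &
    s * 2^-1 ^+ k.+1 < q.2].
  have ex : exists j, s * 2^-1 ^+ j < q.2 by exists N.
  case: (ex_minnP ex) => -[|k] kq kmin; first by move: kq; rewrite mulr1 ltNge qs.
  by exists k; split; [exact: kmin|rewrite leNgt; apply/negP => /kmin; rewrite ltnn|].
set t := 2^-1 ^+ k : R; have t0 : 0 < t by rewrite exprn_gt0.
set P := grid_cover (s * t) q.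
have st0 : 0 < s * t by rewrite mulr_gt0.
have P0 : 0 < P.2 by rewrite /= mulr_gt0.
have qP : box q `<=` box P by apply: sub_boxP; exact: sub_grid_cover.
have oP : 0 <= osc f P by exact: osc_ge0.
have tx : 0 <= t * `|av f P - c| by exact: mulr_ge0 (ltW t0) _.
have oP' : 0 <= 4 ^+ n * osc f P by exact: mulr_ge0 (exprn_ge0 _ _) oP.
have ty : 0 <= t * (4 ^+ n * osc f P) by exact: mulr_ge0 (ltW t0) oP'.
have diff : `|av f q - c| <= `|av f P - c| + 4 ^+ n * osc f P.
  rewrite [leRHS]addrC (le_trans (ler_distD (av f P) _ _))// lerD2r.
  apply: (le_trans (av_diff q0 P0 If qP)); rewrite ler_wpM2r//.
  rewrite lerXn2r ?nnegrE//; first by rewrite divr_ge0 ?(ltW q0) ?(ltW P0).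
  rewrite /= ler_pdivrMr//; move: kq; rewrite exprSr mulrA -/t; lra.
have qt : q.2 / s <= t by rewrite ler_pdivrMr// mulrC.
apply: (@le_trans _ _ ((t * `|av f P - c| + t * (4 ^+ n * osc f P)) `^ p)).
  apply: ge0_ler_powR; rewrite ?nnegrE ?(ltW p0)//.
  - by rewrite mulr_ge0// divr_ge0// ltW.
  - exact: addr_ge0.
  - rewrite -mulrDr; apply: (@le_trans _ _ (t * `|av f q - c|)).
      by rewrite ler_wpM2r.
    by rewrite ler_pM2l.
apply: (le_trans (powRD_le tx ty)).
rewrite ler_pM2l ?powR_gt0//.
apply: le_trans (lerD (grid_chain c If s0 q0 qk) (lexx _)) _.
rewrite -addrA lerD2l.
pose G j := 2^-1 ^+ j * osc f (grid_cover (s * 2^-1 ^+ j) q) `^ p : R.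
have G0 j : 0 <= G j by rewrite mulr_ge0 ?powR_ge0 ?exprn_ge0.
apply: (@le_trans _ _ ((4 ^+ n) `^ p * \sum_(j < k.+1) G j)).
  rewrite big_ord_recr /= mulrDr; apply: lerD.
    apply: ler_wpM2r; first by apply: sumr_ge0 => j _; exact: G0.
    apply: ge0_ler_powR; rewrite ?nnegrE ?(ltW p0) ?exprn_ge0//.
    by rewrite lerXn2r ?nnegrE// ler_nat.
  rewrite (powRM _ (ltW t0) oP') (powRM _ (exprn_ge0 _ _) oP)//.
  by rewrite /G -/t -/P mulrCA ler_wpM2l ?powR_ge0// ler_wpM2r ?powR_ge0// powR_half_le.
rewrite ler_wpM2l ?powR_ge0//.
rewrite (big_ord_widen_cond N xpredT G kN) big_mkcond [leRHS]big_mkcond.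
apply: ler_sum => j _; rewrite andTb ltnS; case: ifPn => jk; last first.
  by case: ifP => // _; exact: G0.
rewrite ifT// (le_trans qk)// ler_pM2l//.
by rewrite ler_wiXn2l// ?invr_ge0// invf_le1// ler1n.
Qed.

(** This sum measures how much the variation of a cutoff function at scale [s]
    contributes to the John-Nirenberg sums of its product with [f - c]. The
    chains of [grid_chain_small] bound it by sums over grid cubes of the sides
    [2 * s / 2 ^+ j], each at most [2 ^+ n * e `^ p] by [sum_grid_cover], with
    the summable weights [2^-1 ^+ j]. *)
Lemma sum_small_boxes f F (c e A s r : R) : box_integrable f -> 0 < s ->
  0 <= e -> 0 <= A ->
  (forall G, family G -> all (sep (origin_box r)) G ->
    \sum_(q <- G) jn_term p f q <= e `^ p) ->
  (forall q, 0 < q.2 -> sep (origin_box r) q ->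
    `|av f q - c| <= A * (e * scale n p q.2)) ->
  family F -> all (fun q => q.2 <= s) F ->
  all (fun q => sep (origin_box r) (grid_cover s q)) F ->
  all (sub_box^~ (origin_box (10 * s))) F ->
  \sum_(q <- F) q.2 ^+ n * (q.2 / s * `|av f q - c|) `^ p <=
  2 `^ p * (10 ^+ n * A `^ p + 2 * (2 ^+ n * (4 ^+ n) `^ p)) * e `^ p.
Proof.
move=> If s0 e0 A0 tail dec FF Fs Fr Fsub.
have F0 q : q \in F -> 0 < q.2 by move=> qF; case/andP : FF => /allP/(_ _ qF).
have [N FN] : exists N, forall q, q \in F -> s * 2^-1 ^+ N < q.2.
  elim: (F) F0 => [|q G IH] F0; first by exists 0%N.
  have [|N GN] := IH; first by move=> q' q'G; apply: F0; rewrite inE q'G orbT.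
  have q0 : 0 < q.2 by apply: F0; rewrite mem_head.
  have [M qM] : exists M, s * 2^-1 ^+ M < q.2.
    exists (Num.truncn (s / q.2)).+1; rewrite exprVn ltr_pdivrMr ?exprn_gt0//.
    rewrite mulrC -ltr_pdivrMr// (lt_trans (truncnS_gt _))//.
    by rewrite -natrX ltr_nat ltn_expl.
  have mono a b : (a <= b)%N -> s * 2^-1 ^+ b <= s * 2^-1 ^+ a.
    by move=> ab; rewrite ler_pM2l// ler_wiXn2l// ?invr_ge0// invf_le1// ler1n.
  exists (maxn M N) => q'; rewrite inE => /orP[/eqP ->|/GN q'N].
    by apply: le_lt_trans qM; apply: mono; exact: leq_maxl.
  by apply: le_lt_trans q'N; apply: mono; exact: leq_maxr.
pose O j q := q.2 ^+ n * osc f (grid_cover (s * 2^-1 ^+ j) q) `^ p : R.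
apply: (@le_trans _ _ (\sum_(q <- F) 2 `^ p *
   (A `^ p * e `^ p * (2 * s) ^- n * q.2 ^+ n + (4 ^+ n) `^ p *
     \sum_(j < N | q.2 <= s * 2^-1 ^+ j) 2^-1 ^+ j * O j q))).
  rewrite big_seq [leRHS]big_seq; apply: ler_sum => q qF.
  have q0 := F0 _ qF.
  rewrite -ler_pdivlMl ?exprn_gt0// mulrCA.
  have qs : 0 < q.2 <= s by rewrite q0; exact: (allP Fs).
  apply: (le_trans (grid_chain_small c If s0 qs (FN _ qF))).
  rewrite ler_pM2l ?powR_gt0// mulrDr; apply: lerD.
    rewrite mulrC mulfK ?expf_neq0 ?gt_eqF//.
    have cov0 : 0 < (grid_cover s q).2 by rewrite /= mulr_gt0.
    have := dec _ cov0 (allP Fr _ qF).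
    have sc0 : 0 <= scale n p (2 * s) by rewrite ltW// scale_gt0// mulr_gt0.
    have -> : A `^ p * e `^ p * (2 * s) ^- n = (A * (e * scale n p (2 * s))) `^ p.
      by rewrite !powRM ?mulr_ge0// scale_powR ?mulr_gt0// mulrA.
    by move=> h; apply: ge0_ler_powR; rewrite ?nnegrE ?(ltW p0)// !mulr_ge0.
  rewrite mulrCA ler_wpM2l ?powR_ge0// mulr_sumr; apply: ler_sum => j _.
  rewrite mulrCA ler_wpM2l ?exprn_ge0 ?invr_ge0// /O mulrA mulVf ?mul1r//.
  by rewrite expf_neq0// gt_eqF.
rewrite -mulr_sumr -[leRHS]mulrA ler_pM2l ?powR_gt0//.
rewrite big_split /= [leRHS]mulrDl; apply: lerD.
  rewrite -mulr_sumr.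
  have h : \sum_(q <- F) q.2 ^+ n <= (2 * (10 * s)) ^+ n.
    by apply: (sum_vol_le FF _ Fsub) => /=; lra.
  apply: (@le_trans _ _ (A `^ p * e `^ p * (2 * s) ^- n * (2 * (10 * s)) ^+ n)).
    by rewrite ler_wpM2l// mulr_ge0 ?mulr_ge0 ?powR_ge0// invr_ge0 exprn_ge0//; lra.
  rewrite le_eqVlt; apply/orP; left; apply/eqP.
  have -> : 2 * (10 * s) = (2 * s) * 10 by ring.
  have s20 : 2 * s != 0 by rewrite mulf_neq0// gt_eqF.
  rewrite (exprMn _ (2 * s) 10) mulrA divfK ?expf_neq0//.
  by rewrite mulrC mulrA.
rewrite -mulr_sumr.
have -> : 2 * (2 ^+ n * (4 ^+ n) `^ p) * e `^ p =
    (4 ^+ n) `^ p * (2 ^+ n * e `^ p * 2) by ring.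
rewrite ler_wpM2l ?powR_ge0//.
under eq_bigr => q _ do rewrite big_mkcond.
rewrite exchange_big /=.
apply: (@le_trans _ _ (\sum_(j < N) 2^-1 ^+ j * (2 ^+ n * e `^ p))).
  apply: ler_sum => j _; rewrite -big_mkcond -mulr_sumr.
  rewrite ler_pM2l ?exprn_gt0// -big_filter.
  have sj0 : 0 < s * 2^-1 ^+ j by rewrite mulr_gt0// exprn_gt0.
  apply: (sum_grid_cover sj0 tail); first exact: family_filter.
    by rewrite all_filter; apply/allP => q _; apply/implyP.
  rewrite all_filter; apply/allP => q qF; apply/implyP => qj.
  rewrite sepC; apply: (sep_sub _ (q' := grid_cover s q)); last first.
    by rewrite sepC; exact: (allP Fr).
  elim: (val j) => [|k IH].
    by rewrite mulr1; apply/forallP => i; rewrite !lexx.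
  apply: sub_box_trans IH; rewrite exprSr mulrA; apply: grid_cover_half.
  by rewrite mulr_gt0// exprn_gt0.
rewrite -mulr_suml mulrC ler_wpM2l ?mulr_ge0 ?powR_ge0 ?exprn_ge0//.
suff -> : \sum_(j < N) (2^-1 : R) ^+ j = 2 - 2 * 2^-1 ^+ N.
  by rewrite gerBl mulr_ge0// exprn_ge0.
elim: N {FN} => [|N IH]; first by rewrite big_ord0; ring.
by rewrite big_ord_recr /= IH exprS; field.
Qed.

End chains.

(** * Smooth functions: sums, products, chain rule *)

Section smooth_closure.
Variables (R : realType) (n : nat).
Local Notation V := 'rV[R]_n.
Implicit Types (f g h : V -> R) (i j : 'I_n) (x : V) (C : set (V -> R)).
Local Notation e_ i := (delta_mx ord0 i : V).

Lemma smooth_coind C :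
  (forall f, C f -> [/\ continuous f, forall i x, derivable f x (e_ i) &
    forall i, C (partial i f)]) ->
  C `<=` @smooth R n.
Proof.
move=> HC f Cf s; suff /HC[] : C (foldr (@partial R n) f s) by [].
by elim: s => //= i s IH; have [_ _] := HC _ IH; exact.
Qed.

Lemma smooth_continuous f : smooth f -> continuous f.
Proof. by move=> /(_ [::])[]. Qed.

Lemma smooth_derivable f : smooth f -> forall i x, derivable f x (e_ i).
Proof. by move=> /(_ [::])[]. Qed.

Lemma smooth_partial f i : smooth f -> smooth (partial i f).
Proof. by move=> sf s; have := sf (rcons s i); rewrite foldr_rcons. Qed.

Lemma partial_cst (c : R) i : partial i ((fun=> c) : V -> R) = (fun=> 0).
Proof. by apply/funext => x; rewrite /partial derive_cst. Qed.

Lemma smooth_cst (c : R) : smooth ((fun=> c) : V -> R).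
Proof.
apply: (@smooth_coind [set f | exists c : R, f = (fun=> c)]); last by exists c.
move=> _ [d ->]; split=> [x|i x|i]; first exact: cst_continuous.
  exact: derivable_cst.
by exists 0; exact: partial_cst.
Qed.

Lemma smooth_affine (k m : R) j : smooth (fun x : V => k * x ord0 j + m).
Proof.
pose D := fun x : V => k * x ord0 j + m.
have cD : continuous D.
  move=> x; apply: (@continuousD _ _ _ (fun x : V => k * x ord0 j) (fun=> m)).
    apply: (@continuousM _ _ (fun=> k) (fun x : V => x ord0 j)).
      exact: cst_continuous.
    exact: coord_continuous.
  exact: cst_continuous.
have dD i x : is_derive x (e_ i) D (k * (j == i)%:R).
  have dq : (fun t : R => t^-1 *: (D (t *: e_ i + x) - D x)) @ 0^' --> k * (j == i)%:R.
    apply: cvg_near_cst; near=> t.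
    have t0 : t != 0 by near: t; exact: nbhs_dnbhs_neq.
    have scaleE (a b : R) : a *: b = a * b by [].
    by rewrite scaleE /D !mxE eqxx /=; field.
  split; first by apply/cvg_ex; eexists; exact: dq.
  by apply: cvg_lim => //; exact: dq.
apply: (@smooth_coind [set f | f = D \/ exists c : R, f = (fun=> c)]); last by left.
move=> f [->|[c ->]].
  split=> [x|i x|i]; first exact: cD.
    by have [] := dD i x.
  right; exists (k * (j == i)%:R); apply/funext => x.
  by have [_] := dD i x.
have sc := smooth_cst c; split; [exact: smooth_continuous|exact: smooth_derivable|].
by move=> i; right; exists 0; exact: partial_cst.
Unshelve. all: by end_near. Qed.

Lemma smoothD f g : smooth f -> smooth g -> smooth (fun x => f x + g x).
Proof.
move=> sf sg; apply: (@smooth_coind [set h | exists f g, [/\ smooth f, smooth g &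
  h = (fun x => f x + g x)]]); last by exists f, g.
move=> _ [{sf}f [{sg}g [sf sg ->]]]; split=> [x|i x|i].
- by apply: (@continuousD _ _ _ f g); exact: smooth_continuous.
- by apply: derivableD; exact: smooth_derivable.
- exists (partial i f), (partial i g); split; [exact: smooth_partial..|].
  by apply/funext => x; apply: deriveD; exact: smooth_derivable.
Qed.

(** With the sum given by the list of its pairs of factors, the Leibniz rule is an
    operation on lists. *)
Definition sum_prod (L : seq ((V -> R) * (V -> R))) : V -> R :=
  fun x => \sum_(ab <- L) ab.1 x * ab.2 x.

(** The Leibniz rule keeps the sums of products within one class as soon as the
    partial derivatives of the factors do; this covers products of smooth
    functions as well as the chain rule. *)
Lemma smooth_sum_prod (A B : set (V -> R)) L :
  (forall a, A a -> [/\ continuous a, forall i x, derivable a x (e_ i) &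
    forall i, A (partial i a)]) ->
  (forall b, B b -> continuous b /\ forall i x, derivable b x (e_ i)) ->
  (forall a b i, A a -> B b -> exists a' b', [/\ A a', B b' &
    forall x, a x * partial i b x = a' x * b' x]) ->
  (forall ab, List.In ab L -> A ab.1 /\ B ab.2) ->
  smooth (sum_prod L).
Proof.
move=> HA HB HAB.
pose good L := forall ab, List.In ab L -> A ab.1 /\ B ab.2.
move=> gL; apply: (@smooth_coind [set h | exists2 L, good L & h = sum_prod L]);
  last by exists L.
move=> _ [{gL}L + ->]; elim: L => [|[a b] L IH] gL.
  have -> : sum_prod [::] = (fun=> 0) by apply/funext => x; rewrite /sum_prod big_nil.
  split; [exact: cst_continuous|move=> i x; exact: derivable_cst|move=> i].
  exists [::] => //; rewrite partial_cst.
  by apply/funext => x; rewrite /sum_prod big_nil.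
have -> : sum_prod ((a, b) :: L) = (fun x => a x * b x + sum_prod L x).
  by apply/funext => x; rewrite /sum_prod big_cons.
have [Aa Bb] : A a /\ B b by apply: (gL (a, b)); left.
have [cL dL pL] : [/\ continuous (sum_prod L),
    forall i x, derivable (sum_prod L) x (e_ i) &
    forall i, exists2 L', good L' & partial i (sum_prod L) = sum_prod L'].
  by apply: IH => ab abL; apply: gL; right.
have [ca da pa] := HA _ Aa; have [cb db] := HB _ Bb.
have dab i x : derivable (fun x => a x * b x) x (e_ i) by exact: derivableM.
split=> [x|i x|i].
- apply: (@continuousD _ _ _ (fun x => a x * b x) (sum_prod L)); last exact: cL.
  by apply: (@continuousM _ _ a b); [exact: ca|exact: cb].
- exact: (derivableD (dab i x) (dL i x)).
have [L' gL' L'E] := pL i.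
have [a' [b' [Aa' Bb' ab']]] := HAB _ _ i Aa Bb.
exists ((a', b') :: (partial i a, b) :: L').
  by move=> ab [<-|[<-|/gL']] //; split => //=; exact: pa.
apply/funext => x; rewrite /sum_prod !big_cons /= -[\sum_(_ <- _) _]/(sum_prod L' x).
rewrite -L'E /partial (deriveD (dab i x) (dL i x)) (deriveM (da i x) (db i x)).
by rewrite -ab' addrA [partial i a x * _]mulrC.
Qed.

Lemma smoothM f g : smooth f -> smooth g -> smooth (fun x => f x * g x).
Proof.
have props a : smooth a -> [/\ continuous a, forall i x, derivable a x (e_ i) &
    forall i, smooth (partial i a)].
  by move=> sa; split; [exact: smooth_continuous|exact: smooth_derivable|
    move=> i; exact: smooth_partial].
move=> sf sg; have -> : (fun x => f x * g x) = sum_prod [:: (f, g)].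
  by apply/funext => x; rewrite /sum_prod big_seq1.
apply: (@smooth_sum_prod (@smooth R n) (@smooth R n) _ props).
- by move=> b /props[cb db _]; split; [exact: cb|exact: db].
- move=> a b i sa sb; exists a, (partial i b).
  by split; [exact: sa|exact: smooth_partial|].
- by move=> _ [<-|[]]; split; [exact: sf|exact: sg].
Qed.

Lemma smooth_sum (I : Type) (s : seq I) (F : I -> V -> R) :
  (forall k, smooth (F k)) -> smooth (fun x => \sum_(k <- s) F k x).
Proof.
move=> sF; elim: s => [|k s IH].
  have -> : (fun x => \sum_(k <- [::]) F k x) = (fun=> 0).
    by apply/funext => x; rewrite big_nil.
  exact: smooth_cst.
have -> : (fun x => \sum_(l <- k :: s) F l x) =
    (fun x => F k x + \sum_(l <- s) F l x).
  by apply/funext => x; rewrite big_cons.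
exact: (smoothD (sF k) IH).
Qed.

Lemma is_derive_comp (eta : R -> R) (D : V -> R) x v (d : R) :
  derivable D x v -> is_derive (D x) (1 : R) eta d ->
  is_derive x v (eta \o D) (d * 'D_v D x).
Proof.
have lineE (f : V -> R) : 'D_v f x = derive1 (fun t : R => f (t *: v + x)) 0.
  rewrite derive1E /derive; set g1 := fun t : R => t^-1 *: _;
  set g2 := fun t : R => t^-1 *: _.
  suff -> : g1 = g2 by [].
  apply/funext => t; rewrite /g1 /g2 /=.
  by rewrite addr0 scale0r add0r [_%:A]mulr1.
move=> dD [de <-]; pose Dl := fun t : R => D (t *: v + x).
have Dl0 : Dl 0 = D x by rewrite /Dl scale0r add0r.
have dDl : derivable Dl 0 1 by exact: (derivable1P D x v).1.
split.
  apply/(derivable1P (eta \o D) x v); apply/derivable1_diffP.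
  apply: (@differentiable_comp _ _ _ _ Dl eta); first exact/derivable1_diffP.
  by apply/derivable1_diffP; rewrite Dl0; exact: de.
rewrite (lineE (eta \o D)) (lineE D) -derive1E -Dl0.
by apply: (@derive1_comp _ Dl eta); [exact: dDl|rewrite Dl0; exact: de].
Qed.

End smooth_closure.

(** * A smooth cutoff function *)

Section flat_functions.
Variable R : realType.
Implicit Types (P : {poly R}) (x y : R).

(** All the derivatives of the function [exp (- 1 / x)], extended by 0 to the
    left of 0, have this form. *)
Definition flat P x : R := if 0 < x then P.[x^-1] * expR (- x^-1) else 0.

Lemma flat_le0 P x : x <= 0 -> flat P x = 0.
Proof. by move=> x0; rewrite /flat ltNge x0. Qed.

Lemma flat_gt0 P x : 0 < x -> flat P x = P.[x^-1] * expR (- x^-1).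
Proof. by move=> x0; rewrite /flat x0. Qed.

Lemma exprn_le_expR m (t : R) : 0 <= t -> t ^+ m.+1 <= m.+1`!%:R * expR t.
Proof.
move=> t0; rewrite mulrC -ler_pdivrMr ?ltr0n ?fact_gt0//.
by apply: le_trans (expR_ge1Dxn m t0); rewrite lerDr.
Qed.

(** Whence the differentiability at 0. *)
Lemma flat_quadratic P : exists2 C, 0 <= C & forall x, `|flat P x| <= C * x ^+ 2.
Proof.
exists (\sum_(i < size P) `|P`_i| * i.+2`!%:R).
  by apply: sumr_ge0 => i _; rewrite mulr_ge0.
move=> x; have [x0|x0] := leP x 0.
  by rewrite flat_le0// normr0 mulr_ge0 ?sqr_ge0// sumr_ge0// => i _; rewrite mulr_ge0.
set t := x^-1; have t0 : 0 < t by rewrite invr_gt0.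
have -> : x = t^-1 by rewrite invrK.
rewrite flat_gt0 ?invr_gt0// invrK normrM (gtr0_norm (expR_gt0 _)) expRN.
rewrite exprVn ler_pdivrMr ?expR_gt0// mulrAC ler_pdivlMr ?exprn_gt0//.
rewrite horner_coef mulr_suml.
apply: (@le_trans _ _ ((\sum_(i < size P) `|P`_i| * t ^+ i) * t ^+ 2)).
  rewrite ler_wpM2r ?sqr_ge0// (le_trans (ler_norm_sum _ _ _))//.
  apply: ler_sum => i _; rewrite normrM ler_wpM2l//.
  by rewrite ger0_norm// exprn_ge0// ltW.
rewrite mulr_suml; apply: ler_sum => i _; rewrite -!mulrA ler_wpM2l//.
by rewrite -exprD addn2; apply: exprn_le_expR; exact: ltW.
Qed.

Definition flat_deriv P : {poly R} := (P - P^`()) * 'X^2.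

Lemma is_derive_flat P x : is_derive x (1 : R) (flat P) (flat (flat_deriv P) x).
Proof.
have [x0|x0|->] := ltgtP x 0.
- rewrite flat_le0 ?(ltW x0)//; apply: (@near_eq_is_derive _ _ _ (cst 0)).
    near=> y; rewrite flat_le0//; apply: ltW.
    by near: y; exact: lt_nbhsl.
- rewrite flat_gt0//.
  pose inv := fun y : R => y^-1.
  have dinv : is_derive x (1 : R) inv (- x ^- 2).
    split; first by apply: (@derivableV _ _ id) => //; rewrite gt_eqF.
    rewrite (@deriveV _ _ id) ?gt_eqF//.
    by rewrite derive_id [_ *: _]mulr1.
  apply: (@near_eq_is_derive _ _ _ ((horner P \o inv) * (expR \o (- inv)))).
    near=> y; rewrite flat_gt0//.
    by near: y; exact: lt_nbhsr.
  have dG : is_derive x (1:R) ((horner P \o inv) * (expR \o (- inv)))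
     (P.[inv x] * (expR (- inv x) * (- - x ^- 2)) +
      expR (- inv x) * (P^`().[inv x] * (- x ^- 2))).
    exact: is_deriveM.
  apply: is_derive_eq.
  by rewrite /flat_deriv /inv hornerM hornerD hornerN hornerXn exprVn; ring.
- rewrite flat_le0//; have [C C0 PC] := flat_quadratic P.
  have lim0 : (fun h : R => h^-1 *:
      ((flat P \o shift 0) (h *: 1) - flat P 0)) @ 0^' --> (0 : R).
    apply/cvgr0Pnorm_lt => e e0; near=> h.
    have h0 : h != 0 by near: h; exact: nbhs_dnbhs_neq.
    have f0 : flat P 0 = 0 by exact: flat_le0.
    have he : `|h| < e / (C + 1).
      near: h; apply: dnbhs0_lt; rewrite divr_gt0//; lra.
    have scaleE (a b : R) : a *: b = a * b by [].
    rewrite /= f0 subr0 addr0 !scaleE mulr1 normrM normfV.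
    rewrite ltr_pdivrMl ?normr_gt0//.
    apply: (le_lt_trans (PC h)).
    rewrite -real_normK ?num_real// expr2 mulrCA ltr_pM2l ?normr_gt0//.
    by move: he; rewrite ltr_pdivlMr; [have := normr_ge0 h; nra|lra].
  split; first by apply/cvg_ex; exists 0.
  exact: cvg_lim lim0.
Unshelve. all: by end_near. Qed.

Lemma continuous_flat P : continuous (flat P).
Proof.
move=> x; apply: differentiable_continuous; apply/derivable1_diffP.
by have [] := is_derive_flat P x.
Qed.

Lemma flat1_ge0 x : 0 <= flat 1 x.
Proof.
have [x0|x0] := leP x 0; first by rewrite flat_le0.
by rewrite flat_gt0// hornerC mul1r expR_ge0.
Qed.

Lemma flat1_le x : x <= 1 -> expR 1 * flat 1 x <= 1.
Proof.
move=> x1; have [x0|x0] := leP x 0; first by rewrite flat_le0// mulr0.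
rewrite flat_gt0// hornerC mul1r -expRD -[leRHS]expR0 ler_expR subr_le0.
by rewrite invf_ge1.
Qed.

Lemma flat1_ge x : 1 <= x -> 1 <= expR 1 * flat 1 x.
Proof.
move=> x1; have x0 : 0 < x by lra.
rewrite flat_gt0// hornerC mul1r -expRD -[leLHS]expR0 ler_expR subr_ge0.
by rewrite invf_le1.
Qed.

(** The derivative is [t ^+ 2 * expR (- t)] with [t = x^-1]. *)
Lemma flat1_lipschitz x y : `|flat 1 x - flat 1 y| <= 2 * `|x - y|.
Proof.
wlog xy : x y / x <= y => [H|].
  by have [/H//|/ltW/H] := leP x y; rewrite distrC [`|y - x|]distrC.
rewrite distrC [`|x - y|]distrC.
have [c _ ->] := MVT_segment xy (fun z _ => @is_derive_flat 1 z)
  (continuous_subspaceT (@continuous_flat 1)).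
rewrite normrM ler_wpM2r//.
have [c0|c0] := leP c 0; first by rewrite flat_le0// normr0.
rewrite flat_gt0// /flat_deriv derivC subr0 mul1r hornerXn expRN normrM.
rewrite ger0_norm ?exprn_ge0 ?invr_ge0 ?(ltW c0)//.
rewrite ger0_norm ?invr_ge0 ?expR_ge0// ler_pdivrMr ?expR_gt0//.
by apply: (@exprn_le_expR 1); rewrite invr_ge0 ltW.
Qed.

End flat_functions.

Section cutoff.
Variables (R : realType) (n : nat).
Local Notation V := 'rV[R]_n.
Implicit Types (x y : V) (M : R).

Lemma smooth_flat_comp (D : V -> R) P : smooth D -> smooth (fun x => flat P (D x)).
Proof.
move=> sD; pose B := [set f : V -> R | exists P, f = flat P \o D].
have sm1 (a : V -> R) : smooth a -> [/\ continuous a,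
    forall i x, derivable a x (delta_mx ord0 i) & forall i, smooth (partial i a)].
  by move=> sa; split; [exact: smooth_continuous|exact: smooth_derivable|
    move=> i; exact: smooth_partial].
have dB Q i x : is_derive x (delta_mx ord0 i) (flat Q \o D)
    (flat (flat_deriv Q) (D x) * partial i D x).
  by apply: is_derive_comp; [exact: smooth_derivable|exact: is_derive_flat].
have -> : (fun x => flat P (D x)) = sum_prod [:: (fun=> 1, flat P \o D)].
  by apply/funext => x; rewrite /sum_prod big_seq1 mul1r.
apply: (@smooth_sum_prod _ _ (@smooth R n) B) => //.
- move=> _ [Q ->]; split=> [x|i x]; last by have [] := dB Q i x.
  by apply: continuous_comp; [exact: smooth_continuous|exact: continuous_flat].
- move=> a _ i sa [Q ->].
  exists (fun x => a x * partial i D x), (flat (flat_deriv Q) \o D).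
  split; [by apply: smoothM => //; exact: smooth_partial|by exists (flat_deriv Q)|].
  move=> x; have [_ dE] := dB Q i x.
  by rewrite [partial i _ x]dE /= mulrCA mulrC [_ * flat _ _]mulrC.
- by move=> _ [<-|[]]; split; [exact: smooth_cst|exists P].
Qed.

(** On [origin_box M] all the arguments of [flat 1] are negative, so that the sum
    vanishes; off [origin_box (2 * M)] one of them is at least 1, so that the sum is
    at least [expR (-1)]. *)
Definition wall M x : R :=
  \sum_(i < n) (flat 1 (M^-1 * x ord0 i + -1) + flat 1 (- M^-1 * x ord0 i + -1)).

(** The argument of [flat 1] is 1 on [origin_box M], which gives the value 1, and
    is not positive off [origin_box (2 * M)], which gives the value 0. *)
Definition cutoff M x : R := expR 1 * flat 1 (- expR 1 * wall M x + 1).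

Lemma wall_ge0 M x : 0 <= wall M x.
Proof. by apply: sumr_ge0 => i _; rewrite addr_ge0// flat1_ge0. Qed.

Lemma smooth_cutoff M : smooth (cutoff M).
Proof.
apply: smoothM; first exact: smooth_cst.
apply: smooth_flat_comp; apply: smoothD; last exact: smooth_cst.
apply: smoothM; first exact: smooth_cst.
apply: smooth_sum => i.
by apply: smoothD; apply: smooth_flat_comp; exact: smooth_affine.
Qed.

Lemma cutoff_ge0 M x : 0 <= cutoff M x.
Proof. by rewrite mulr_ge0 ?expR_ge0 ?flat1_ge0. Qed.

Lemma cutoff_le1 M x : cutoff M x <= 1.
Proof.
by apply: flat1_le; rewrite gerDr mulNr oppr_le0 mulr_ge0 ?expR_ge0 ?wall_ge0.
Qed.

Lemma cutoff_eq1 M x : 0 < M -> (forall i, `|x ord0 i| <= M) -> cutoff M x = 1.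
Proof.
move=> M0 xM; have w0 : wall M x = 0.
  apply: big1 => i _; have := xM i; rewrite ler_norml => /andP[h1 h2].
  rewrite !flat_le0 ?addr0// subr_le0.
    by rewrite mulNr -mulrN mulrC ler_pdivrMr//; lra.
  by rewrite mulrC ler_pdivrMr//; lra.
rewrite /cutoff w0 mulr0 add0r flat_gt0// hornerC mul1r invr1 -expRD.
by rewrite subrr expR0.
Qed.

Lemma cutoff_eq0 M x i : 0 < M -> 2 * M <= `|x ord0 i| -> cutoff M x = 0.
Proof.
move=> M0 xM; rewrite /cutoff flat_le0 ?mulr0//.
suff : 1 <= expR 1 * wall M x by rewrite mulNr; lra.
set t := fun i => flat 1 (M^-1 * x ord0 i + -1) + flat 1 (- M^-1 * x ord0 i + -1).
have ti : 1 <= expR 1 * t i.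
  rewrite /t mulrDr; have /orP[h|h] : (2 * M <= x ord0 i) || (2 * M <= - x ord0 i).
  - by move: xM; rewrite ler_normr.
  - have /flat1_ge h1 : 1 <= M^-1 * x ord0 i + -1.
      by rewrite -lerBlDr mulrC ler_pdivlMr//; lra.
    by rewrite (le_trans h1)// lerDl mulr_ge0 ?expR_ge0 ?flat1_ge0.
  - have /flat1_ge h1 : 1 <= - M^-1 * x ord0 i + -1.
      by rewrite -lerBlDr mulNr -mulrN mulrC ler_pdivlMr//; lra.
    by rewrite (le_trans h1)// lerDr mulr_ge0 ?expR_ge0 ?flat1_ge0.
apply: (le_trans ti); rewrite ler_pM2l ?expR_gt0// /wall (bigD1 i)//= lerDl.
by apply: sumr_ge0 => j _; rewrite addr_ge0// flat1_ge0.
Qed.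

Lemma cutoff_lipschitz M x y (d : R) : 0 < M ->
  (forall i, `|x ord0 i - y ord0 i| <= d) ->
  `|cutoff M x - cutoff M y| <= 8 * expR 1 ^+ 2 * n%:R * (d / M).
Proof.
move=> M0 xyd; have k0 := expR_gt0 (1 : R).
have dw : `|wall M x - wall M y| <= n%:R * (4 * (d / M)).
  rewrite /wall -sumrB (le_trans (ler_norm_sum _ _ _))//.
  rewrite -[n in n%:R](card_ord n) mulr_natl -sumr_const; apply: ler_sum => i _.
  rewrite opprD addrACA (le_trans (ler_normD _ _))//.
  have step (k : R) : `|k| = M^-1 ->
      `|flat 1 (k * x ord0 i + -1) - flat 1 (k * y ord0 i + -1)| <= 2 * (d / M).
    move=> kM; apply: (le_trans (flat1_lipschitz _ _)); rewrite ler_pM2l//.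
    rewrite opprD addrACA subrr addr0 -mulrBr normrM kM mulrC.
    by rewrite ler_pM2r ?invr_gt0.
  have M1 : `|M^-1| = M^-1 by rewrite gtr0_norm// invr_gt0.
  have := step _ M1; have : `|- M^-1| = M^-1 by rewrite normrN.
  by move=> /step; lra.
rewrite /cutoff -mulrBr normrM gtr0_norm//.
apply: (@le_trans _ _ (expR 1 * (2 * (expR 1 * (n%:R * (4 * (d / M)))))));
  last by rewrite le_eqVlt; apply/orP; left; apply/eqP; ring.
rewrite ler_pM2l// (le_trans (flat1_lipschitz _ _))// ler_pM2l//.
have -> : - expR 1 * wall M x + 1 - (- expR 1 * wall M y + 1) =
    - (expR 1 * (wall M x - wall M y)) by ring.
by rewrite normrN normrM (gtr0_norm k0) ler_pM2l.
Qed.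

End cutoff.

(** * Measurability of continuous functions *)

Section measurability.
Variables (R : realType) (n : nat).
Local Notation V := 'rV[R]_n.
Local Notation mu := (@lebesgue_rV R n).
Local Notation LV := (caratheodory_type (mu_ext (borel_lebesgue R n))).

(** Open sets are countable unions of cubes with rational data. *)
Lemma open_measurable_rV (U : set V) : open U -> measurable U.
Proof.
move=> oU; pose B (ak : 'rV[rat]_n * nat) : set V :=
  [set y : V | forall i, ball (ratr (ak.1 ord0 i) : R) (ak.2.+1%:R^-1) (y ord0 i)].
pose F ak := if `[< B ak `<=` U >] then B ak else set0.
have -> : U = \bigcup_ak F ak.
  apply/seteqP; split => [x Ux|x [ak _]]; last first.
    by rewrite /F; case: asboolP => // BU; exact: BU.
  have /nbhs_ballP[e /= e0 xe] : nbhs x U by exact: open_nbhs_nbhs.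
  pose k := Num.truncn (2 / e).
  have ke : 2 * k.+1%:R^-1 < e.
    rewrite ltr_pdivrMr// mulrC -ltr_pdivrMr//; exact: truncnS_gt.
  have /choice[a ax] : forall i, exists a : rat,
      ball (ratr a : R) (k.+1%:R^-1) (x ord0 i).
    move=> i; have : x ord0 i < x ord0 i + k.+1%:R^-1 by rewrite ltrDl invr_gt0.
    move=> /rat_in_itvoo[a]; rewrite in_itv /= => /andP[h1 h2]; exists a.
    have d0 : 0 < k.+1%:R^-1 :> R by rewrite invr_gt0.
    rewrite -ball_normE /= ltr_distlC.
    by rewrite ltrBlDr h2 (lt_trans h1) ?ltrDl.
  exists (\row_i a i, k) => //; rewrite /F asboolT.
    by move=> i; rewrite mxE.
  move=> y By; apply: xe; split => // j i; rewrite (ord1 j).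
  have := By i; have := ax i; rewrite -!ball_normE /= !mxE => h1 h2.
  rewrite (le_lt_trans (ler_distD (ratr (a i)) _ _))// (distrC (x _ _)).
  by apply: (lt_trans (ltrD h1 h2)); rewrite -mulr2n -(mulr_natl _ 2).
apply: countable_bigcupT_measurable => // ak; rewrite /F.
case: asboolP => // _.
apply: (@measurable_box _ _
  (fun i => ball (ratr (ak.1 ord0 i) : R) (ak.2.+1%:R^-1))) => i.
exact: measurable_ball.
Qed.

Lemma continuous_measurable_rV (f : V -> R) : continuous f ->
  measurable_fun setT (f : LV -> R).
Proof.
move=> cf; apply: (measurability _ (RGenOpens.measurableE R)) => _ [_ [a [b ->] <-]].
rewrite setTI; apply: measurable_lebesgue; apply: open_measurable_rV.
by apply: open_comp => [x _|]; [exact: cf|exact: interval_open].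
Qed.

End measurability.

(** * The John-Nirenberg sums of the remainder *)

Section truncation.
Variables (R : realType) (n : nat) (p : R).
Hypothesis p1 : 1 < p.
Local Notation V := 'rV[R]_n.
Implicit Types (f g : V -> R) (q : V * R) (F : seq (V * R)) (c M : R).

Let p0 : 0 < p. Proof. exact: lt_trans p1. Qed.

(** What is left of [f] when [f - c] is cut off at scale [M]. *)
Definition remainder f c M : V -> R := fun x => f x - cutoff M x * (f x - c).

Lemma remainder_subc f c M x :
  remainder f c M x - c = (1 - cutoff M x) * (f x - c).
Proof. by rewrite /remainder; ring. Qed.

Lemma box_integrable_remainder f c M : box_integrable f ->
  box_integrable (remainder f c M).
Proof.
move=> If; apply: box_integrableB => //.
apply: (@box_integrable_bounded _ _ _ _ 1).
- by apply: box_integrableB => //; exact: box_integrable_cst.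
- by apply: continuous_measurable_rV; apply: smooth_continuous; exact: smooth_cutoff.
- by move=> x; rewrite ger0_norm ?cutoff_ge0 ?cutoff_le1.
Qed.

Lemma norm_remainder_le f c M x : `|remainder f c M x - c| <= `|f x - c|.
Proof.
rewrite remainder_subc normrM ger0_norm ?subr_ge0 ?cutoff_le1//.
by rewrite ler_piMl// gerBl cutoff_ge0.
Qed.

Definition cutoff_cst : R := 8 * expR 1 ^+ 2 * n%:R.

(** A product rule for oscillations: with the cutoff frozen at the centre of [q]
    and [f] replaced by its average, the remainder changes by a multiple of
    [f - av f q] and a multiple of the variation of the cutoff. *)
Lemma osc_remainder_le f c M q : box_integrable f -> 0 < M -> 0 < q.2 ->
  osc (remainder f c M) q <=
  2 * (osc f q + cutoff_cst * (q.2 / M) * `|av f q - c|).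
Proof.
move=> If M0 q0; pose x0 : V := \row_i (q.1 ord0 i + q.2 / 2).
pose w := c + (1 - cutoff M x0) * (av f q - c).
apply: (le_trans (osc_le q0 w (box_integrable_remainder _ _ If))).
rewrite ler_pM2l//; set K := cutoff_cst * _ * _.
apply: (@le_trans _ _ (av (fun x => `|f x - av f q| + K) q)); last first.
  by rewrite avD// ?av_cst//; [exact: box_integrable_distC|exact: box_integrable_cst].
apply: av_le => //.
- exact/box_integrable_distC/box_integrable_remainder.
- by apply: box_integrableD; [exact: box_integrable_distC|exact: box_integrable_cst].
move=> x qx.
have -> : remainder f c M x - w = (1 - cutoff M x) * (f x - av f q) +
    (cutoff M x0 - cutoff M x) * (av f q - c).
  rewrite /w /remainder.
  by move: (av f q) (cutoff M x) (cutoff M x0) (f x) => a t t0 y; ring.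
rewrite (le_trans (ler_normD _ _))//; apply: lerD; rewrite normrM.
  rewrite ger0_norm ?subr_ge0 ?cutoff_le1//.
  by rewrite ler_piMl// gerBl cutoff_ge0.
rewrite ler_wpM2r//; apply: cutoff_lipschitz => // i.
by have /andP[? ?] := qx i; rewrite mxE ler_norml; apply/andP; split; lra.
Qed.

Lemma osc_remainder_inside f c M q : box_integrable f -> 0 < M -> 0 < q.2 ->
  sub_box q (origin_box M) -> osc (remainder f c M) q = 0.
Proof.
move=> If M0 q0 /forallP qM; apply/eqP; rewrite eq_le osc_ge0// andbT.
apply: (le_trans (osc_le q0 c (box_integrable_remainder _ _ If))).
rewrite (@av_eq _ _ _ _ (fun=> 0)) ?av_cst ?mulr0// => x qx.
rewrite remainder_subc cutoff_eq1 ?subrr ?mul0r ?normr0// => i.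
have := qM i; rewrite /= !mxE => /andP[? ?]; have /andP[? ?] := qx i.
by rewrite ler_norml; apply/andP; split; lra.
Qed.

Lemma osc_remainder_outside f c M q : box_integrable f -> 0 < M -> 0 < q.2 ->
  sep (origin_box (2 * M)) q -> osc (remainder f c M) q <= 2 * osc f q.
Proof.
move=> If M0 q0 /existsP[i]; rewrite /= !mxE => qM.
apply: (le_trans (osc_le q0 (av f q) (box_integrable_remainder _ _ If))).
rewrite ler_pM2l// [leRHS]osc_av le_eqVlt; apply/orP; left; apply/eqP.
apply: av_eq => x qx; rewrite /remainder (@cutoff_eq0 _ _ _ _ i) ?mul0r ?subr0//.
have /andP[? ?] := qx i; rewrite ler_normr.
by case/orP : qM => ?; apply/orP; [left|right]; lra.
Qed.

(** The part of a cube off [origin_box M] is covered by [2 n] translates of the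
    cube that lie off [origin_box M]. *)
Lemma av_remainder_le f c M q (b : R) : box_integrable f -> 0 < M -> 0 < q.2 ->
  (forall q', q'.2 = q.2 -> sep (origin_box M) q' ->
    av (fun x => `|f x - c|) q' <= b) ->
  av (fun x => `|remainder f c M x - c|) q <= n%:R * 2 * b.
Proof.
move=> If M0 q0 Hb.
pose up i : V * R :=
  (\row_j if j == i then Num.max (q.1 ord0 i) M else q.1 ord0 j, q.2).
pose dn i : V * R :=
  (\row_j if j == i then Num.min (q.1 ord0 i) (- M - q.2) else q.1 ord0 j, q.2).
pose cov := [seq up i | i <- enum 'I_n] ++ [seq dn i | i <- enum 'I_n].
have upM i : sep (origin_box M) (up i).
  apply/existsP; exists i; rewrite /= !mxE eqxx; apply/orP; left.
  have -> : - M + 2 * M = M by ring.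
  by rewrite le_max lexx orbT.
have dnM i : sep (origin_box M) (dn i).
  apply/existsP; exists i; rewrite /= !mxE eqxx; apply/orP; right.
  by rewrite -lerBrDr ge_min lexx orbT.
apply: (@le_trans _ _ (\sum_(q' <- cov) av (fun x => `|f x - c|) q')).
  apply: av_cover => //.
  - exact/box_integrable_distC/box_integrable_remainder.
  - exact: box_integrable_distC.
  - by move=> q'; rewrite mem_cat => /orP[] /mapP[i _ ->].
  move=> x qx; have [/forallP xM|] := boolP [forall i, `|x ord0 i| <= M].
    by left; rewrite remainder_subc cutoff_eq1// subrr mul0r normr0.
  rewrite negb_forall => /existsP[i]; rewrite -ltNge => xiM; right.
  have le_c := norm_remainder_le f c M x.
  have /andP[x1 x2] := qx i.
  move: xiM; rewrite lter_normr => /orP[xiM|xiM].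
    exists (up i); first by rewrite mem_cat map_f// mem_enum.
    split=> // j; rewrite !mxE; case: eqP => [->|_]; last exact: qx.
    rewrite gt_max x1 xiM /= (lt_le_trans x2)// lerD2r.
    by rewrite le_max lexx.
  exists (dn i); first by rewrite mem_cat (map_f dn) ?orbT// mem_enum.
  split=> // j; rewrite !mxE; case: eqP => [->|_]; last exact: qx.
  rewrite gt_min x1 /= -ltrBlDr lt_min; apply/andP; split; lra.
rewrite big_cat /= !big_map.
have sum_le (h : 'I_n -> V * R) : (forall i, (h i).2 = q.2) ->
    (forall i, sep (origin_box M) (h i)) ->
    \sum_i av (fun x => `|f x - c|) (h i) <= n%:R * b.
  move=> hq hM; apply: (@le_trans _ _ (\sum_(i < n) b)).
    by apply: ler_sum => i _; exact: Hb.
  by rewrite sumr_const card_ord mulr_natl.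
rewrite mulrAC mulr_natr mulr2n; apply: lerD.
  exact: (sum_le up).
exact: (sum_le dn).
Qed.

Lemma family_map (h : V * R -> V * R) F : family F ->
  (forall q, q \in F -> 0 < (h q).2) -> (forall q, q \in F -> sub_box (h q) q) ->
  family (map h F).
Proof.
elim: F => // q F IH; rewrite family_cons => /and3P[q0 qF FF] h0 hs.
rewrite /= family_cons h0 ?mem_head//= IH//; last 2 first.
- by move=> q' q'F; apply: h0; rewrite inE q'F orbT.
- by move=> q' q'F; apply: hs; rewrite inE q'F orbT.
rewrite andbT; apply/allP => _ /mapP[q' q'F ->].
apply: (sep_sub (hs _ (mem_head _ _))); rewrite sepC.
apply: (sep_sub (hs q' _)); first by rewrite inE q'F orbT.
by rewrite sepC; exact: (allP qF).
Qed.

(** Only boundedly many disjoint large cubes meet a given cube around the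
    origin: each of them contains a cube of side [s] close to the origin. *)
Lemma size_large_family s F : 0 < s -> family F ->
  all (fun q => (s < q.2) && ~~ sep (origin_box (8 * s)) q) F ->
  (size F)%:R <= 18 ^+ n :> R.
Proof.
move=> s0 FF Fs.
pose h q : V * R := (\row_i Num.max (q.1 ord0 i) (- (9 * s)), s).
have lo q i : q \in F -> - (8 * s) < q.1 ord0 i + q.2 /\ q.1 ord0 i < 8 * s.
  move=> /(allP Fs)/andP[_]; rewrite negb_exists => /forallP/(_ i).
  by rewrite negb_or -!ltNge /= !mxE => /andP[? ?]; split; lra.
have sq q : q \in F -> s < q.2 by move=> /(allP Fs)/andP[].
have hF : family (map h F).
  apply: family_map => // q qF; apply/forallP => i; rewrite /= mxE.
  rewrite le_max lexx /= -lerBrDr ge_max; have := sq _ qF; have [] := lo _ i qF.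
  by move=> ? ? ?; apply/andP; split; lra.
have hs : all (sub_box^~ (origin_box (9 * s))) (map h F).
  apply/allP => _ /mapP[q qF ->]; apply/forallP => i; rewrite /= !mxE.
  rewrite le_max lexx orbT /= -lerBrDr ge_max; have [] := lo _ i qF.
  by move=> ? ?; apply/andP; split; lra.
have := sum_vol_le hF _ hs; rewrite big_map /= big_const_seq count_predT.
rewrite iter_addr addr0 => H.
have {}H : (size F)%:R * s ^+ n <= 18 ^+ n * s ^+ n.
  rewrite mulr_natl (le_trans (H _))//; first by lra.
  by rewrite mulrA exprMn -natrM.
by move: H; rewrite ler_pM2r// exprn_gt0.
Qed.

(** The cubes split into four kinds. The large ones that meet
    [origin_box (8 * s)] are boundedly many, and each contributes at most a
    multiple of [e `^ p] by [av_remainder_le]. The cubes inside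
    [origin_box (4 * s)] contribute nothing. The cubes off
    [origin_box (8 * s)] contribute as for [f], and the remaining ones, small
    and near the boundary of [origin_box (4 * s)], are the subject of
    [osc_remainder_le] and [sum_small_boxes]. *)
Lemma sum_remainder_le f c (e A s : R) F : box_integrable f -> 0 < s ->
  0 <= e -> 0 <= A ->
  (forall G, family G -> all (sep (origin_box (2 * s))) G ->
    \sum_(q <- G) jn_term p f q <= e `^ p) ->
  (forall q, 0 < q.2 -> sep (origin_box (2 * s)) q ->
    `|av f q - c| <= A * (e * scale n p q.2)) ->
  family F ->
  \sum_(q <- F) jn_term p (remainder f c (4 * s)) q <=
  (18 ^+ n * (2 * (n%:R * 2 * (1 + A))) `^ p +
   (4 `^ p + (2 `^ p * (2 * cutoff_cst) `^ p) *
     (2 `^ p * (10 ^+ n * A `^ p + 2 * (2 ^+ n * (4 ^+ n) `^ p))))) * e `^ p.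
Proof.
move=> If s0 e0 A0 tail dec FF.
have M0 : 0 < 4 * s by rewrite mulr_gt0.
have s28 : 2 * s <= 8 * s by lra.
have s24 : 2 * s <= 4 * s by lra.
have s14 : s <= 4 * s by lra.
have F0 q : q \in F -> 0 < q.2 by move=> qF; case/andP : FF => /allP/(_ _ qF).
have k0 : 0 <= cutoff_cst by rewrite !mulr_ge0 ?exprn_ge0 ?expR_ge0.
set rem := remainder f c (4 * s).
pose large q := (s < q.2) && ~~ sep (origin_box (8 * s)) q.
pose near q := [&& q.2 <= s, ~~ sub_box q (origin_box (4 * s)) &
  ~~ sep (origin_box (8 * s)) q].
pose far q := sep (origin_box (2 * s)) q.
have tailM q r : 2 * s <= r -> sep (origin_box r) q -> sep (origin_box (2 * s)) q.
  by move=> sr; apply: sep_sub; exact: sub_origin_box.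
have avc q : 0 < q.2 -> far q ->
    av (fun x => `|f x - c|) q <= (1 + A) * (e * scale n p q.2).
  move=> q0 fq.
  apply: (@le_trans _ _ (av (fun x => `|f x - av f q| + `|av f q - c|) q)).
    apply: av_le => //; first exact: box_integrable_distC.
      by apply: box_integrableD; [exact: box_integrable_distC|exact: box_integrable_cst].
    by move=> x _; exact: ler_distD.
  rewrite avD//; [|exact: box_integrable_distC|exact: box_integrable_cst].
  rewrite av_cst// mulrDl mul1r; apply: lerD; last exact: dec.
  rewrite -osc_av; apply: osc_le_scale => //.
  have := tail [:: q]; rewrite big_seq1; apply; first by rewrite /family /= q0.
  by rewrite /= andbT.
have large_le q : 0 < q.2 ->
    jn_term p rem q <= (2 * (n%:R * 2 * (1 + A))) `^ p * e `^ p.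
  move=> q0; have sc0 := @scale_gt0 _ n p _ q0.
  have osc_rem : osc rem q <= 2 * (n%:R * 2 * (1 + A)) * (e * scale n p q.2).
    apply: (le_trans (osc_le q0 c (box_integrable_remainder _ _ If))).
    rewrite -[leRHS]mulrA ler_pM2l// -[leRHS]mulrA.
    apply: av_remainder_le => // q' q'q q'M.
    by rewrite -q'q; apply: avc; [rewrite q'q|exact: tailM s24 q'M].
  have B0 : 0 <= 2 * (n%:R * 2 * (1 + A)) by rewrite !mulr_ge0// addr_ge0.
  apply: (@le_trans _ _ (q.2 ^+ n *
      (2 * (n%:R * 2 * (1 + A)) * (e * scale n p q.2)) `^ p)).
    rewrite ler_pM2l ?exprn_gt0//.
    apply: ge0_ler_powR; rewrite ?nnegrE ?(ltW p0)//; first exact: osc_ge0.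
    by rewrite mulr_ge0// mulr_ge0// ltW.
  rewrite (powRM _ B0) ?mulr_ge0 ?(ltW sc0)// (powRM _ e0 (ltW sc0)) scale_powR//.
  rewrite le_eqVlt; apply/orP; left; apply/eqP.
  by field; rewrite expf_neq0// gt_eqF.
have near_sub q : q \in F -> near q ->
    sub_box q (origin_box (10 * s)) /\ sep (origin_box (2 * s)) (grid_cover s q).
  move=> qF /and3P[qs]; rewrite negb_forall negb_exists => /existsP[i qi] /forallP q8.
  have q0 := F0 _ qF; split.
    apply/forallP => j; have := q8 j; rewrite negb_or -!ltNge /= !mxE => /andP[? ?].
    by apply/andP; split; lra.
  apply/existsP; exists i; rewrite grid_coverE.
  have /andP[h1 h2] := grid_index_itv q.1 i s0.
  move: (s * _) h1 h2 qi => b h1 h2; rewrite negb_and -!ltNge /= !mxE => qi.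
  by case/orP: qi => qi; apply/orP; [right|left]; lra.
have near_far q : q \in F -> near q -> far q.
  move=> qF nq; have [_ h] := near_sub _ qF nq; rewrite /far sepC.
  by apply: sep_sub; [apply: sub_grid_cover s0 _; case/and3P : nq|rewrite sepC].
pose T q := (q.2 / s * `|av f q - c|) `^ p.
have small_le q : q \in F -> ~~ large q -> jn_term p rem q <=
    (if far q then 4 `^ p * jn_term p f q else 0) +
    (if near q then 2 `^ p * (2 * cutoff_cst) `^ p * (q.2 ^+ n * T q) else 0).
  move=> qF; have q0 := F0 _ qF; have qn0 : 0 < q.2 ^+ n by rewrite exprn_gt0.
  have j0 : 0 <= 4 `^ p * jn_term p f q by rewrite mulr_ge0 ?powR_ge0// jn_term_ge0.
  have T0 : 0 <= 2 `^ p * (2 * cutoff_cst) `^ p * (q.2 ^+ n * T q).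
    by rewrite !mulr_ge0 ?powR_ge0// ltW.
  have o0 := osc_ge0 q0 f; have or0 := osc_ge0 q0 rem.
  have E4 : (4 : R) `^ p = 2 `^ p * 2 `^ p by rewrite -powRM// -natrM.
  rewrite /large negb_and negbK => /orP lq.
  have [q8|q8] := boolP (sep (origin_box (8 * s)) q).
    have fq : far q by exact: tailM s28 q8.
    rewrite fq (_ : near q = false) ?addr0; last by rewrite /near q8 !andbF.
    apply: (@le_trans _ _ (q.2 ^+ n * (2 * osc f q) `^ p)).
      rewrite ler_pM2l//; apply: ge0_ler_powR; rewrite ?nnegrE ?(ltW p0)//.
        exact: mulr_ge0 (ler0n _ 2) o0.
      apply: osc_remainder_outside => //.
      by have -> : 2 * (4 * s) = 8 * s by ring.
    rewrite powRM// mulrCA E4 -mulrA ler_pM2l ?powR_gt0//.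
    have h1 : 1 <= (2 : R) `^ p by rewrite -[leLHS](powRr0 2) ler_powR ?(ltW p0)// ler1n.
    by rewrite ler_peMl// jn_term_ge0.
  have qs : q.2 <= s by case: lq => [|/(negP q8)//]; rewrite -leNgt.
  have [q4|q4] := boolP (sub_box q (origin_box (4 * s))).
    rewrite /jn_term osc_remainder_inside// powR0 ?gt_eqF// mulr0.
    by rewrite addr_ge0//; case: ifP.
  have nq : near q by rewrite /near qs q4 q8.
  rewrite nq near_far//; set y := cutoff_cst * (q.2 / s * `|av f q - c|).
  have qs0 : 0 <= q.2 / s by rewrite divr_ge0 ?(ltW q0) ?(ltW s0).
  have y0 : 0 <= y by rewrite mulr_ge0// mulr_ge0.
  apply: (@le_trans _ _ (q.2 ^+ n * (2 * (osc f q + y)) `^ p)).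
    rewrite ler_pM2l//; apply: ge0_ler_powR; rewrite ?nnegrE ?(ltW p0)//.
      exact: mulr_ge0 (ler0n _ 2) (addr_ge0 o0 y0).
    apply: (le_trans (osc_remainder_le c If M0 q0)).
    rewrite ler_pM2l// lerD2l -mulrA ler_wpM2l// ler_wpM2r// ler_wpM2l ?(ltW q0)//.
    by rewrite lef_pV2 ?posrE.
  have yE : (2 * y) `^ p = (2 * cutoff_cst) `^ p * T q.
    rewrite /T -powRM//; [|by rewrite mulr_ge0|by rewrite mulr_ge0].
    by rewrite /y mulrA.
  rewrite mulrDr; apply: (@le_trans _ _ (q.2 ^+ n *
      (2 `^ p * ((2 * osc f q) `^ p + (2 * y) `^ p)))).
    rewrite ler_pM2l//.
    exact: (powRD_le p1 (mulr_ge0 (ler0n _ 2) o0) (mulr_ge0 (ler0n _ 2) y0)).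
  rewrite le_eqVlt; apply/orP; left; apply/eqP.
  rewrite yE (powRM _ (ler0n _ 2) o0) E4 /jn_term.
  move: (_ `^ p) (_ `^ p) (_ `^ p) (T q) (q.2 ^+ n) => a b d t v; ring.
rewrite (bigID large) /= [leRHS]mulrDl; apply: lerD.
  rewrite -big_filter.
  apply: (@le_trans _ _ (\sum_(q <- [seq q <- F | large q])
     (2 * (n%:R * 2 * (1 + A))) `^ p * e `^ p)).
    rewrite big_seq [leRHS]big_seq; apply: ler_sum => q.
    by rewrite mem_filter => /andP[_ qF]; apply: large_le; exact: F0.
  rewrite big_const_seq count_predT iter_addr addr0 -[leLHS]mulr_natl -[leRHS]mulrA.
  rewrite ler_wpM2r ?mulr_ge0 ?powR_ge0//.
  apply: (@size_large_family s) => //; first exact: family_filter.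
  exact: filter_all.
apply: (@le_trans _ _ (\sum_(q <- F)
   ((if far q then 4 `^ p * jn_term p f q else 0) +
    (if near q then 2 `^ p * (2 * cutoff_cst) `^ p * (q.2 ^+ n * T q) else 0)))).
  rewrite big_mkcond /= big_seq [leRHS]big_seq; apply: ler_sum => q qF.
  case: ifP => [lq|_]; first by apply: small_le => //; rewrite lq.
  apply: addr_ge0; case: ifP => // _.
    by rewrite mulr_ge0 ?powR_ge0// jn_term_ge0// F0.
  by rewrite !mulr_ge0 ?powR_ge0// exprn_ge0// ltW// F0.
rewrite big_split /= -!big_mkcond -!mulr_sumr [leRHS]mulrDl; apply: lerD.
  rewrite ler_pM2l ?powR_gt0// -big_filter; apply: tail; first exact: family_filter.
  exact: filter_all.
rewrite -[leRHS]mulrA ler_wpM2l ?mulr_ge0 ?powR_ge0// -big_filter.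
have fam := family_filter near FF.
apply: (sum_small_boxes p1 If s0 e0 A0 tail dec fam).
- by apply/allP => q; rewrite mem_filter => /andP[/and3P[]].
- by apply/allP => q; rewrite mem_filter => /andP[nq qF]; case: (near_sub _ qF nq).
- by apply/allP => q; rewrite mem_filter => /andP[nq qF]; case: (near_sub _ qF nq).
Qed.

End truncation.

(** * Compactly supported smooth functions *)

Section compact_support.
Variables (R : realType) (n : nat).
Local Notation V := 'rV[R]_n.
Local Notation mu := (@lebesgue_rV R n).
Local Notation LV := (caratheodory_type (mu_ext (borel_lebesgue R n))).
Implicit Types (f g h : V -> R) (K : set V).

Lemma hausdorff_rV : hausdorff_space V.
Proof. by case: n => [|k]; exact: norm_hausdorff. Qed.

Lemma continuous_compact_bounded h K : continuous h -> compact K ->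
  exists2 B, 0 <= B & forall x, K x -> `|h x| <= B.
Proof.
move=> ch cK; have /compact_bounded[M [_ hM]] : compact (h @` K).
  by apply: continuous_compact => //; exact: continuous_subspaceT.
exists (`|M| + 1); first by rewrite addr_ge0.
by move=> x Kx; apply: hM; [rewrite (le_lt_trans (ler_norm M))// ltrDl|exists x].
Qed.

Lemma compact_sub_box K : compact K -> exists r, K `<=` box (origin_box r).
Proof.
move=> cK.
have /choice[b bK] : forall i, exists b,
    0 <= b /\ forall x, K x -> `|x ord0 i| <= b.
  move=> i; have [b b0 bK] := continuous_compact_bounded
    (@coord_continuous R 1 n ord0 i) cK.
  by exists b.
exists (\sum_i b i + 1).
move=> x Kx i; have [_ /(_ _ Kx)] := bK i; rewrite /= !mxE ler_norml => /andP[h1 h2].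
have : b i <= \sum_i b i by rewrite (bigD1 i)//= lerDl sumr_ge0// => j _; case: (bK j).
by move=> h3; apply/andP; split; lra.
Qed.

Lemma compact_supportP g (M : R) : (forall (x : V) i, M <= `|x ord0 i| -> g x = 0) ->
  compact (closure [set x | g x != 0]).
Proof.
move=> gM; pose K := [set x : V | forall i, `[- M, M]%classic (x ord0 i)].
have cK : compact K.
  by apply: (@rV_compact _ _ (fun=> `[- M, M]%classic)) => i; exact: segment_compact.
apply: (subclosed_compact _ cK); first exact: closed_closure.
have /closure_id -> : closed K by exact: (compact_closed hausdorff_rV cK).
apply: closureS => x /= gx i; rewrite /= in_itv /= -ler_norml leNgt.
apply/negP => h.
by move/eqP: gx; apply; apply: (gM x i); exact: ltW.
Qed.

Lemma bounded_support_integrable h (B r : R) : measurable_fun setT (h : LV -> R) ->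
  (forall x, `|h x| <= B) -> (forall x, ~ box (origin_box r) x -> h x = 0) ->
  mu.-integrable setT (EFin \o h).
Proof.
move=> mh hB hr; pose Q : set V := box (origin_box r).
have mQ : measurable (Q : set LV) by exact: measurable_box_lebesgue.
have -> : EFin \o h = (EFin \o h) \_ Q.
  apply/funext => x; rewrite patchE; case: ifPn => // /negP xQ /=.
  by rewrite hr// => /mem_set.
apply/(integrable_mkcond _ mQ).
apply: (@le_integrable _ _ _ _ _ mQ _ (EFin \o (fun=> B))).
- by apply/measurable_EFinP; exact: measurable_funTS.
- by move=> x _; rewrite /= lee_fin (le_trans (hB x))// ler_norm.
- exact: box_integrable_cst.
Qed.

Lemma bounded_support_L1loc h (B r : R) : continuous h ->
  (forall x, `|h x| <= B) -> (forall x, ~ box (origin_box r) x -> h x = 0) ->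
  L1loc h.
Proof.
move=> ch hB hr; have mh := continuous_measurable_rV ch; split => // K cK.
have mK : measurable (K : set LV).
  rewrite -[K]setCK; apply: measurableC; apply: measurable_lebesgue.
  apply: open_measurable_rV; rewrite openC.
  exact: (compact_closed hausdorff_rV cK).
apply: (@integrableS _ _ _ mu setT) => //.
exact: bounded_support_integrable hB hr.
Qed.

Lemma continuous_grad_norm g : smooth g -> continuous (grad_norm g).
Proof.
move=> sg; pose S := fun x => \sum_(i < n) partial i g x * partial i g x.
have -> : grad_norm g = Num.sqrt \o S.
  by apply/funext => x; rewrite /grad_norm /S /=; under eq_bigr do rewrite expr2.
have cS : continuous S.
  apply: smooth_continuous; apply: smooth_sum => i.
  by apply: smoothM; exact: smooth_partial.
by move=> x; apply: continuous_comp; [exact: cS|exact: sqrt_continuous].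
Qed.

Lemma Ccoo_bounded_support g : Ccoo g -> exists B r, [/\ 0 <= B,
  (forall x, `|g x| <= B), (forall x, ~ box (origin_box r) x -> g x = 0),
  (forall x, `|grad_norm g x| <= B) &
  (forall x, ~ box (origin_box r) x -> grad_norm g x = 0)].
Proof.
move=> [sg cK]; set K := closure _ in cK.
have g0 x : ~ K x -> g x = 0.
  by move=> Kx; apply/eqP/negPn/negP => gx; apply: Kx; exact: subset_closure.
have pg0 i x : ~ K x -> partial i g x = 0.
  move=> Kx; have oK : open (~` K) by rewrite openC; exact: closed_closure.
  rewrite /partial (@near_eq_derive _ _ _ g (cst 0)) ?derive_cst//.
  near=> y; apply: g0; near: y; exact: open_nbhs_nbhs.
have gn0 x : ~ K x -> grad_norm g x = 0.
  by move=> Kx; rewrite /grad_norm big1 ?sqrtr0// => i _; rewrite pg0// expr0n.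
have cgn := continuous_grad_norm sg.
have [r Kr] := compact_sub_box cK.
have [B1 B10 gB1] := continuous_compact_bounded (smooth_continuous sg) cK.
have [B2 B20 gB2] := continuous_compact_bounded cgn cK.
exists (B1 + B2), r; split => //; first exact: addr_ge0.
- move=> x; have [Kx|Kx] := pselect (K x); first by rewrite (le_trans (gB1 x Kx))// lerDl.
  by rewrite g0// normr0 addr_ge0.
- by move=> x xr; apply: g0 => /Kr.
- move=> x; have [Kx|Kx] := pselect (K x); first by rewrite (le_trans (gB2 x Kx))// lerDr.
  by rewrite gn0// normr0 addr_ge0.
- by move=> x xr; apply: gn0 => /Kr.
Unshelve. all: by end_near. Qed.

Lemma Ccoo_D_ p g : 1 < p -> Ccoo g -> D_ p g.
Proof.
move=> p1 Cg; have [sg _] := Cg; split => //.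
have [B [r [B0 _ _ hB hr]]] := Ccoo_bounded_support Cg.
have cgn : measurable_fun setT (grad_norm g : LV -> R).
  exact: continuous_measurable_rV (continuous_grad_norm sg).
rewrite inE; apply/andP; split; rewrite inE //=.
rewrite /finite_norm unlock; apply: poweR_lty.
have p0 : 0 < p by exact: lt_trans p1.
have /integrableP[_] : mu.-integrable setT (EFin \o (fun x => `|grad_norm g x| `^ p)).
  apply: (@bounded_support_integrable _ (B `^ p) r).
  - apply: (measurableT_comp (measurable_powR p)).
    exact: measurableT_comp.
  - move=> x; rewrite ger0_norm ?powR_ge0//.
    by apply: ge0_ler_powR; rewrite ?nnegrE ?(ltW p0).
  - by move=> x /hr ->; rewrite normr0 powR0// gt_eqF.
congr (_ < _)%E; apply: eq_integral => x _ /=.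
by rewrite ger0_norm// powR_ge0.
Qed.

(** For a function bounded by [B], the [p]-th power of the average over a cube is
    at most [B `^ (p - 1)] times the average, so that the John-Nirenberg sums are
    dominated by sums of integrals over disjoint cubes. *)
Lemma Ccoo_JN p g : 1 < p -> Ccoo g -> JN p g.
Proof.
move=> p1 Cg; have [sg _] := Cg.
have [B [r [B0 hB hr _ _]]] := Ccoo_bounded_support Cg.
have cg := smooth_continuous sg.
have Lg : L1loc g := bounded_support_L1loc cg hB hr.
have Ig := L1loc_box_integrable Lg.
have p0 : 0 < p by exact: lt_trans p1.
have Ing : mu.-integrable setT (EFin \o (fun x => `|g x|)).
  exact: integrable_norm (bounded_support_integrable (continuous_measurable_rV cg) hB hr).
pose C := 2 `^ p * B `^ (p - 1) * \int[mu]_x `|g x|.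
have C0 : 0 <= C by rewrite mulr_ge0 ?mulr_ge0 ?powR_ge0// Rintegral_ge0.
split=> //; exists (C `^ p^-1); first exact: powR_ge0.
apply: family_JN_bound => F FF; rewrite -powRrM mulVf ?gt_eqF// powRr1//.
apply: (@le_trans _ _ (\sum_(q <- F) 2 `^ p * B `^ (p - 1) *
    \int[mu]_(x in box q) `|g x|)).
  rewrite big_seq [leRHS]big_seq; apply: ler_sum => q qF.
  have q0 : 0 < q.2 by case/andP : FF => /allP/(_ _ qF).
  have := osc_le q0 0 Ig; under av_eq do rewrite subr0.
  move=> oq; rewrite (Rintegral_av q0) /jn_term mulrCA ler_pM2l ?exprn_gt0//.
  set a := av _ q in oq *.
  have a0 : 0 <= a by exact: av_ge0.
  have aB : a <= B.
    rewrite -(@av_cst _ _ _ q0 B); apply: av_le => //.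
      exact: box_integrable_norm.
    exact: box_integrable_cst.
  apply: (@le_trans _ _ ((2 * a) `^ p)).
    apply: ge0_ler_powR; rewrite ?nnegrE ?(ltW p0)//; first exact: osc_ge0.
    exact: mulr_ge0.
  rewrite powRM// -mulrA ler_pM2l ?powR_gt0// -mulr_powRB1// mulrC ler_wpM2r//.
  by apply: ge0_ler_powR; rewrite ?nnegrE// subr_ge0 ltW.
rewrite -mulr_sumr ler_wpM2l ?mulr_ge0 ?powR_ge0//.
exact: sum_Rintegral_le.
Qed.

End compact_support.

(** * Approximation by compactly supported functions *)

Section closures.
Variables (R : realType) (n : nat) (p : R).
Hypotheses (n0 : (0 < n)%N) (p1 : 1 < p).
Local Notation V := 'rV[R]_n.
Implicit Types (f g : V -> R).

Let p0 : 0 < p. Proof. exact: lt_trans p1. Qed.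

Lemma Ccoo_cutoff f (c M : R) : 0 < M -> smooth f ->
  Ccoo (fun x => cutoff M x * (f x - c)).
Proof.
move=> M0 sf; split.
  apply: smoothM; first exact: smooth_cutoff.
  by apply: smoothD => //; exact: smooth_cst.
apply: (@compact_supportP _ _ _ (2 * M)) => x i xM.
by rewrite (cutoff_eq0 M0 xM) mul0r.
Qed.

(** The cutoffs of [f - c], where [c] is the value of [f] at infinity, approximate
    [f]: the error is controlled by the John-Nirenberg sums of [f] away from the
    origin, which are small by [JN_tail]. *)
Lemma JN_smooth_approx f (d : R) : JN p f -> smooth f -> 0 < d ->
  exists2 g, Ccoo g & JN_bound p (f - g)%R d.
Proof.
move=> [Lf [K K0 fK]] sf d0; have If := L1loc_box_integrable Lf.
have [c fc] := JN_average_limit n0 p0 If K0 fK.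
have /andP[rho0 rho1] := @ratio_bound R n p n0 p0.
pose A : R := 2 ^+ n / (1 - ratio n p).
have A0 : 0 <= A by rewrite divr_ge0 ?exprn_ge0// subr_ge0 ltW.
pose C := 18 ^+ n * (2 * (n%:R * 2 * (1 + A))) `^ p +
   (4 `^ p + (2 `^ p * (2 * cutoff_cst R n) `^ p) *
     (2 `^ p * (10 ^+ n * A `^ p + 2 * (2 ^+ n * (4 ^+ n) `^ p)))).
have C0 : 0 <= C.
  by rewrite !(addr_ge0, mulr_ge0, powR_ge0, exprn_ge0).
pose e := d * (C + 1) `^ (- p^-1).
have e0 : 0 <= e by rewrite mulr_ge0 ?powR_ge0// ltW.
have eE : e `^ p = d `^ p / (C + 1).
  rewrite powRM ?powR_ge0 ?(ltW d0)// -powRrM mulNr mulVf ?gt_eqF//.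
  by rewrite powR_inv1// addr_ge0.
have ep0 : 0 < e `^ p by rewrite eE divr_gt0 ?powR_gt0// ltr_wpDl.
have [r r0 tail] := JN_tail n0 fK ep0.
have r2 : 2 * (r / 2) = r by field.
have s0 : 0 < r / 2 by rewrite divr_gt0.
exists (fun x => cutoff (4 * (r / 2)) x * (f x - c)).
  by apply: Ccoo_cutoff => //; rewrite mulr_gt0.
apply: family_JN_bound => F FF.
apply: (@le_trans _ _ (C * e `^ p)).
  have := @sum_remainder_le _ _ _ p1 f c e A (r / 2) F If s0 e0 A0.
  by rewrite r2; apply=> // q; exact: fc.
rewrite eE mulrCA ler_piMr ?powR_ge0// ler_pdivrMr; last by rewrite ltr_wpDl.
by rewrite mul1r lerDl.
Qed.

(** A crude triangle inequality; since [1 < p], two terms [2 `^ p * K `^ p] are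
    at most [(4 * K) `^ p]. *)
Lemma JN_boundD f g (K L : R) : box_integrable f -> box_integrable g ->
  0 <= K -> 0 <= L -> JN_bound p f K -> JN_bound p g L ->
  JN_bound p (f + g)%R (4 * (K + L)).
Proof.
move=> If Ig K0 L0 fK gL; apply: family_JN_bound => F FF.
have KL0 : 0 <= K + L by exact: addr_ge0.
apply: (@le_trans _ _ (\sum_(q <- F) 2 `^ p * (jn_term p f q + jn_term p g q))).
  rewrite big_seq [leRHS]big_seq; apply: ler_sum => q qF.
  have q0 : 0 < q.2 by case/andP : FF => /allP/(_ _ qF).
  rewrite -mulrDr mulrCA ler_pM2l ?exprn_gt0//.
  have f0 := osc_ge0 q0 f; have g0 := osc_ge0 q0 g.
  have fg0 := osc_ge0 q0 (f + g)%R.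
  apply: le_trans (powRD_le p1 f0 g0).
  apply: (ge0_ler_powR (ltW p0) fg0 (addr_ge0 f0 g0)).
  rewrite !osc_av -avD//; [|exact: box_integrable_distC|exact: box_integrable_distC].
  have fgE : av (f + g)%R q = av f q + av g q by exact: avD.
  apply: av_le => //.
  - by apply: box_integrable_distC; exact: box_integrableD.
  - by apply: box_integrableD; exact: box_integrable_distC.
  - by move=> x _; rewrite fgE opprD addrACA; exact: ler_normD.
rewrite -mulr_sumr big_split /=.
apply: (@le_trans _ _ (2 `^ p * (2 * (K + L) `^ p))).
  rewrite ler_pM2l ?powR_gt0// mulrDl !mul1r; apply: lerD.
    apply: (le_trans (JN_bound_family n0 fK FF)).
    by apply: ge0_ler_powR; rewrite ?nnegrE ?(ltW p0)// lerDl.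
  apply: (le_trans (JN_bound_family n0 gL FF)).
  by apply: ge0_ler_powR; rewrite ?nnegrE ?(ltW p0)// lerDr.
have -> : 4 * (K + L) = 2 * (2 * (K + L)) by ring.
rewrite [leRHS]powRM ?mulr_ge0// ler_pM2l ?powR_gt0// powRM// ler_wpM2r ?powR_ge0//.
by rewrite -[leLHS]powRr1// ler_powR ?(ltW p1)// ler1n.
Qed.

Lemma JN_norm_lt f (d : R) : (JN_norm p f < d%:E)%E ->
  exists K, [/\ 0 <= K, K < d & JN_bound p f K].
Proof. by move=> /ereal_inf_lt[_ [K [K0 fK] <-]]; rewrite lte_fin; exists K. Qed.

Lemma JN_norm_le f (K : R) : 0 <= K -> JN_bound p f K -> (JN_norm p f <= K%:E)%E.
Proof. by move=> K0 fK; apply: ereal_inf_lbound; exists K. Qed.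

End closures.

Theorem corollary3p15 (R : realType) (n : nat) (p : R) :
  (0 < n)%N -> 1 < p -> @CJN R n p = @VJN R n p.
Proof.
move=> n0 p1; apply/seteqP; split=> f [Jf fS]; split => // e e0.
  have [g Cg fg] := fS e e0; exists g; last exact: fg.
  by split; [exact: Ccoo_D_|exact: Ccoo_JN].
(* [JN_boundD] loses a factor 4: the errors add up to 4 * (e / 10 + e / 10) *)
have e10 : 0 < e / 10 by rewrite divr_gt0.
have [g [[sg _] Jg] /JN_norm_lt[K [K0 Ke fgK]]] := fS _ e10.
have [h Ch ghL] := JN_smooth_approx n0 p1 Jg sg e10.
exists h; first exact: Ch.
have If := L1loc_box_integrable Jf.1; have Ig := L1loc_box_integrable Jg.1.
have Ih := L1loc_box_integrable (Ccoo_JN p1 Ch).1.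
have := JN_boundD n0 p1 (box_integrableB If Ig) (box_integrableB Ig Ih)
  K0 (ltW e10) fgK ghL.
rewrite [X in JN_bound _ X](_ : _ = (f - h)%R); last by rewrite addrA subrK.
move=> /JN_norm_le H; apply: le_lt_trans (H _) _; first by lra.
by rewrite lte_fin; lra.
Qed.
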